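(* (1) The function $$g_1(r)=\frac{1}{r^2}\left[\frac{3+r^2}{4}\log\frac{\operatorname{arth} r}{r}-\log\frac{2\mathcal{K}(r)}{\pi}\right]$$ is strictly increasing from $(0,1)$ onto $(0,\log(\pi/2))$, while the function $$g_2(r)=\frac{g_1(r)}{\log((\operatorname{arth} r)/r)}$$ is strictly decreasing from $(0,1)$ onto $(0,79/320)$. (2) Define the functions $g_3$ and $g_4$ on $(0,1)$ by $$g_3(r)=\frac{1}{r^2\log((\operatorname{arth} r)/r)}\left[\log\frac{2\mathcal{K}(r)}{\pi}-\left(\frac34+\frac{1}{320}r^2\right)\log\frac{\operatorname{arth} r}{r}\right],$$ $$g_4(r)=\frac{1}{r^4}\left[\log\frac{2\mathcal{K}(r)}{\pi}-\left(\frac34+\frac{1}{320}r^2\right)\log\frac{\operatorname{arth} r}{r}\right].$$ Then $g_3$ and $g_4$ are both strictly increasing on $(0,1)$, with ranges $(0,79/320)$ and $(0,\infty)$, respectively. (3) Let $$G(r)=\frac{\log(2\mathcal{K}(r)/\pi)}{\log((\operatorname{arth} r)/r)},\qquad f(r)=\frac{1}{r^2}\left[G(r)-\frac34\right],\qquad r\in(0,1).$$ The function $f$ is strictly increasing from $(0,1)$ onto $(1/320,1/4)$. In particular, $G$ is strictly increasing from $(0,1)$ onto $(3/4,1)$, and, for real constants $\alpha,\beta$, the double inequality $$\frac{\pi}{2}\left(\frac{\operatorname{arth} r}{r}\right)^{3/4+\alpha r^2}<\mathcal{K}(r)<\frac{\pi}{2}\left(\frac{\operatorname{arth} r}{r}\right)^{3/4+\beta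 r^2}$$ holds for all $r\in(0,1)$ if and only if $\alpha\leq1/320$ and $\beta\geq1/4$. Moreover, for all $r\in(0,1)$, $$\left(\frac{\pi}{2}\right)^{1-r^2}\left(\frac{\operatorname{arth} r}{r}\right)^{3/4+r^2/4}<\mathcal{K}(r)<\frac{\pi}{2}\left(\frac{\operatorname{arth} r}{r}\right)^{3/4+r^2/4}.$$
   Context: $\operatorname{arth}$ denotes the inverse hyperbolic tangent. For $r\in(0,1)$, $\mathcal{K}(r)=\int_0^{\pi/2}(1-r^2\sin^2t)^{-1/2}\,dt$ is the complete elliptic integral of the first kind. *)

(* Defs.v *)
From Stdlib Require Import Reals Lra.
From Coquelicot Require Import Coquelicot.
Open Scope R_scope.

Definition arth (x : R) : R := ln ((1 + x) / (1 - x)) / 2.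

(* [arth] is the inverse of [tanh], a bijection from R onto (-1, 1). *)

Lemma tanh_arth (x : R) : -1 < x < 1 -> tanh (arth x) = x.
Proof.
intros Hx.
unfold tanh, sinh, cosh, arth.
set (u := ln ((1 + x) / (1 - x)) / 2).
assert (Hq : 0 < (1 + x) / (1 - x)) by (apply Rdiv_lt_0_compat; lra).
assert (Hu : exp u * exp u = (1 + x) / (1 - x)).
{ rewrite <- exp_plus. replace (u + u) with (ln ((1 + x) / (1 - x))) by (unfold u; field).
  now apply exp_ln. }
assert (He := exp_pos u).
rewrite exp_Ropp.
assert (Hm : (1 - x) * (exp u * exp u) = 1 + x) by (rewrite Hu; field; lra).
assert (H1 : 0 < exp u * exp u) by (apply Rmult_lt_0_compat; assumption).
replace ((exp u - / exp u) / 2 / ((exp u + / exp u) / 2))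
  with ((exp u * exp u - 1) / (exp u * exp u + 1)) by (field; split; lra).
apply (Rmult_eq_reg_r (exp u * exp u + 1)); [ | lra ].
unfold Rdiv. rewrite Rmult_assoc, Rinv_l by lra. lra.
Qed.

Lemma arth_tanh (u : R) : -1 < tanh u < 1 /\ arth (tanh u) = u.
Proof.
assert (He := exp_pos u).
assert (H1 : 0 < exp u * exp u) by (apply Rmult_lt_0_compat; assumption).
assert (Ht : tanh u = (exp u * exp u - 1) / (exp u * exp u + 1)).
{ unfold tanh, sinh, cosh. rewrite exp_Ropp. field. split; lra. }
assert (Hp : 1 + tanh u = 2 * (exp u * exp u) / (exp u * exp u + 1))
  by (rewrite Ht; field; lra).
assert (Hm : 1 - tanh u = 2 / (exp u * exp u + 1)) by (rewrite Ht; field; lra).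
assert (0 < 1 + tanh u) by (rewrite Hp; apply Rdiv_lt_0_compat; lra).
assert (0 < 1 - tanh u) by (rewrite Hm; apply Rdiv_lt_0_compat; lra).
split; [ lra | ].
unfold arth.
replace ((1 + tanh u) / (1 - tanh u)) with (exp (u + u)).
- rewrite ln_exp. field.
- rewrite exp_plus, Hp, Hm. field. lra.
Qed.

Definition ellK (r : R) : R :=
  RInt (fun t => / sqrt (1 - r ^ 2 * sin t ^ 2)) 0 (PI / 2).

Definition g1 (r : R) : R :=
  1 / r ^ 2 * ((3 + r ^ 2) / 4 * ln (arth r / r) - ln (2 * ellK r / PI)).

Definition g2 (r : R) : R := g1 r / ln (arth r / r).

Definition g3 (r : R) : R :=
  1 / (r ^ 2 * ln (arth r / r)) *
  (ln (2 * ellK r / PI) - (3 / 4 + 1 / 320 * r ^ 2) * ln (arth r / r)).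

Definition g4 (r : R) : R :=
  1 / r ^ 4 *
  (ln (2 * ellK r / PI) - (3 / 4 + 1 / 320 * r ^ 2) * ln (arth r / r)).

Definition G (r : R) : R := ln (2 * ellK r / PI) / ln (arth r / r).

Definition fG (r : R) : R := 1 / r ^ 2 * (G r - 3 / 4).

Definition strictly_increasing_01 (g : R -> R) : Prop :=
  forall x y : R, 0 < x -> x < y -> y < 1 -> g x < g y.

Definition strictly_decreasing_01 (g : R -> R) : Prop :=
  forall x y : R, 0 < x -> x < y -> y < 1 -> g y < g x.

(* The image of (0, 1) under [g] is exactly the open interval (a, b), whose
   endpoints may be infinite. *)
Definition maps_01_onto (g : R -> R) (a b : Rbar) : Prop :=
  forall y : R,
    (exists r : R, 0 < r < 1 /\ g r = y) <-> (Rbar_lt a y /\ Rbar_lt y b).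

(* Main.v *)
(* Put x = r^2, A = arth r / r, l = log A, m = log (2 K / pi) and f = (m - 3 l / 4) / (x l). Then g1
   = l (1/4 - f), g2 = 1/4 - f, g3 = f - 1/320, g4 = (l / x) (f - 1/320) and G = 3/4 + x f, so
   everything rests on the monotonicity of f and of g1. Two applications of the monotone form of
   l'Hopital's rule remove the logarithms and reduce both to the monotonicity of one quotient S,
   which increases from 1/320 to 1/4 and is rational in x, u = 1 / A and v = E / K. Since u and v
   satisfy Riccati equations in x, the sign of S' is that of a polynomial in x, u and v.

   For x <= 9/10 this polynomial is bounded below by replacing A - 1 and K / E - 1 by truncated
   Taylor series, which the Riccati equations show to be lower and upper bounds, so that only a
   polynomial in x with integer coefficients remains. For x >= 9/10 it is expanded in powers of
   A, and the coefficients are positive because (1 - x) A is small and 0 < K / E - A <= log 2 /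
   r. *)

Require Import Defs.
From Stdlib Require Import Reals.
From Coquelicot Require Import Coquelicot.
From Stdlib Require Import Lra Lia Psatz ZArith List.
Import ListNotations.
Open Scope R_scope.

(** * Calculus on (0, 1) *)

(** The obstacle is that S' has no slack at either end. Its numerator [wronS] equals (1 - x) x^2
    denS^2 S', and since denS has order x, it vanishes to fourth order at 0; bounds on A and K/E
    that are not exact to second order would lose its sign. Hence the denominator 61440 = 15 * 2^12,
    for which the coefficients 1/3, 1/5 of A - 1 and 1/2, 5/16, 7/32, 337/2048, 533/4096 of K/E - 1
    become integers. The same second-order data give the limit 1/320. At the other end A and K/E are
    unbounded, which rules out Taylor polynomials, and [wronS] is identically 0 when x = 1 and u =
    v. Its sign there must come from the terms that are linear in the small quantity (1 - x) A and
    in the bounded quantity K/E - A. The variable x = r^2 makes the derivatives of A, K and E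
    rational in x, A, K and E. The exponent 3/4 is the quotient of the leading terms x/4 of log (2 K
    / pi) and x/3 of log A, so m - 3 l / 4 has no linear term, and a second use of l'Hopital's rule
    is possible. *)

Lemma mvt_open (f df : R -> R) (a b x y : R) :
  (forall t, a < t < b -> is_derive f t (df t)) -> a < x -> x < y -> y < b ->
  exists c, x < c < y /\ f y - f x = df c * (y - x).
Proof.
intros Hd Hx Hxy Hy.
destruct (MVT_cor2 f df x y Hxy) as [c [Hc Hc']].
- intros c Hc. apply is_derive_Reals, Hd. lra.
- exists c. split; [ lra | exact Hc ].
Qed.

Lemma deriv_pos_incr (f df : R -> R) (a b x y : R) :
  (forall t, a < t < b -> is_derive f t (df t)) ->
  (forall t, a < t < b -> 0 < df t) ->
  a < x -> x < y -> y < b -> f x < f y.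
Proof.
intros Hd Hp Hx Hxy Hy. apply (incr_function f a b df); simpl; auto.
intros t Ha Hb. now apply Hp.
Qed.

Lemma filterlim_at_right_0 (f : R -> R) (l : R) :
  filterlim f (at_right 0) (locally l) ->
  forall eps, 0 < eps -> exists d, 0 < d /\ forall t, 0 < t < d -> Rabs (f t - l) < eps.
Proof.
intros Hf eps He.
destruct (proj1 (filterlim_locally f l) Hf (mkposreal eps He)) as [d Hd].
exists d. split; [ apply cond_pos | ].
intros t Ht. apply (Hd t); [ | lra ].
change (Rabs (t - 0) < d). rewrite Rabs_pos_eq; lra.
Qed.

(** The limit replaces a value at 0. If [f] were negative at [x / 2], it would be below that
    negative number at all smaller points, against the limit 0. *)
Lemma deriv_pos_pos (f df : R -> R) (b : R) :
  filterlim f (at_right 0) (locally 0) ->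
  (forall t, 0 < t < b -> is_derive f t (df t)) ->
  (forall t, 0 < t < b -> 0 < df t) ->
  forall x, 0 < x < b -> 0 < f x.
Proof.
intros Hl Hd Hp x Hx.
assert (H1 : f (x / 2) < f x) by (apply (deriv_pos_incr f df 0 b); auto; lra).
destruct (Rle_or_lt 0 (f (x / 2))) as [H2 | H2]; [ lra | exfalso ].
destruct (filterlim_at_right_0 f 0 Hl (- f (x / 2))) as [d [Hd0 Hd1]]; [ lra | ].
set (t := Rmin (d / 2) (x / 4)).
assert (Ht : 0 < t < d /\ t < x / 2).
{ unfold t. split; [ split | ].
  - apply Rmin_glb_lt; lra.
  - apply Rle_lt_trans with (1 := Rmin_l _ _). lra.
  - apply Rle_lt_trans with (1 := Rmin_r _ _). lra. }
assert (H3 : f t < f (x / 2)) by (apply (deriv_pos_incr f df 0 b); auto; lra).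
specialize (Hd1 t (proj1 Ht)). apply Rabs_def2 in Hd1. lra.
Qed.

Section MonotoneLHopital.

Variables (f g rho dg : R -> R).
Hypothesis f0 : filterlim f (at_right 0) (locally 0).
Hypothesis g0 : filterlim g (at_right 0) (locally 0).
Hypothesis df : forall t, 0 < t < 1 -> is_derive f t (rho t * dg t).
Hypothesis dg' : forall t, 0 < t < 1 -> is_derive g t (dg t).
Hypothesis dg_pos : forall t, 0 < t < 1 -> 0 < dg t.

Lemma lhopital_den_pos x : 0 < x < 1 -> 0 < g x.
Proof. apply (deriv_pos_pos g dg); auto. Qed.

Lemma lhopital_lim_comb (c : R) :
  filterlim (fun t => f t - c * g t) (at_right 0) (locally 0).
Proof.
replace 0 with (0 + (- c) * 0) at 2 by ring.
apply filterlim_ext with (fun t => f t + (- c) * g t).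
{ intros t. ring. }
apply (filterlim_comp_2 (G := locally 0) (H := locally ((- c) * 0))
         f (fun t => (- c) * g t) Rplus).
- exact f0.
- apply filterlim_comp with (1 := g0).
  apply (filterlim_scal_r (K := R_AbsRing) (V := R_NormedModule)).
- apply (filterlim_plus (K := R_AbsRing) (V := R_NormedModule)).
Qed.

Lemma lhopital_deriv_comb (c t : R) :
  0 < t < 1 -> is_derive (fun t => f t - c * g t) t ((rho t - c) * dg t).
Proof.
intros Ht.
replace ((rho t - c) * dg t) with (minus (rho t * dg t) (c * dg t))
  by (unfold minus, plus, opp; simpl; ring).
apply (is_derive_minus f (fun t => c * g t)).
- now apply df.
- apply is_derive_scal. now apply dg'.
Qed.

(** The function f - c g tends to 0 at 0 and has derivative (rho - c) g' > 0. Here [rho] plays the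
    role of f'/g', which the hypothesis [df] states without a division. *)
Lemma lhopital_gt (c : R) x :
  0 < x < 1 -> (forall t, 0 < t < x -> c < rho t) -> c < f x / g x.
Proof.
intros Hx Hc.
assert (Hg := lhopital_den_pos).
assert (H : forall s, 0 < s < x -> 0 < f s - c * g s).
{ apply (deriv_pos_pos _ (fun t => (rho t - c) * dg t)).
  - apply lhopital_lim_comb.
  - intros t Ht. apply lhopital_deriv_comb. lra.
  - intros t Ht. apply Rmult_lt_0_compat; [ | apply dg_pos; lra ].
    specialize (Hc t Ht). lra. }
(* [H] stops short of the endpoint [x], where nothing is assumed on [rho]; the mean value theorem on
   [x/2, x] carries positivity there. *)
assert (H1 : 0 < f (x / 2) - c * g (x / 2)) by (apply H; lra).
assert (H2 : f (x / 2) - c * g (x / 2) <= f x - c * g x).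
{ destruct (mvt_open (fun t => f t - c * g t) (fun t => (rho t - c) * dg t)
              0 1 (x / 2) x) as [s [Hs He]]; try lra.
  { intros t Ht. apply lhopital_deriv_comb. lra. }
  assert (0 < rho s - c) by (specialize (Hc s); lra).
  assert (0 < dg s) by (apply dg_pos; lra).
  assert (0 < (rho s - c) * dg s) by (apply Rmult_lt_0_compat; lra). nra. }
apply (Rmult_lt_reg_r (g x)); [ apply Hg, Hx | ].
replace (f x / g x * g x) with (f x); [ lra | ].
field. apply Rgt_not_eq, Hg, Hx.
Qed.

End MonotoneLHopital.

Lemma lhopital_lt (f g rho dg : R -> R) (c x : R) :
  filterlim f (at_right 0) (locally 0) ->
  filterlim g (at_right 0) (locally 0) ->
  (forall t, 0 < t < 1 -> is_derive f t (rho t * dg t)) ->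
  (forall t, 0 < t < 1 -> is_derive g t (dg t)) ->
  (forall t, 0 < t < 1 -> 0 < dg t) ->
  0 < x < 1 -> (forall t, 0 < t < x -> rho t < c) -> f x / g x < c.
Proof.
intros f0 g0 df dg' dg_pos Hx Hc.
apply Ropp_lt_cancel.
replace (- (f x / g x)) with ((- f x) / g x) by (unfold Rdiv; ring).
apply (lhopital_gt (fun t => - f t) g (fun t => - rho t) dg); auto.
- replace 0 with (- 0) at 2 by ring.
  apply filterlim_comp with (1 := f0).
  apply (filterlim_opp (K := R_AbsRing) (V := R_NormedModule)).
- intros t Ht. replace (- rho t * dg t) with (opp (rho t * dg t))
    by (unfold opp; simpl; ring).
  apply (is_derive_opp f). now apply df.
- intros t Ht. specialize (Hc t Ht). lra.
Qed.

(** (f/g)' = g' (rho - f/g) / g, and f/g < rho at each point by [lhopital_lt], because [rho] is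
    smaller to the left of it. *)
Lemma lhopital_incr (f g rho dg : R -> R) :
  filterlim f (at_right 0) (locally 0) ->
  filterlim g (at_right 0) (locally 0) ->
  (forall t, 0 < t < 1 -> is_derive f t (rho t * dg t)) ->
  (forall t, 0 < t < 1 -> is_derive g t (dg t)) ->
  (forall t, 0 < t < 1 -> 0 < dg t) ->
  strictly_increasing_01 rho -> strictly_increasing_01 (fun t => f t / g t).
Proof.
intros f0 g0 df dg' dg_pos Hr x y Hx Hxy Hy.
assert (Hg := lhopital_den_pos g dg g0 dg' dg_pos).
apply (deriv_pos_incr (fun t => f t / g t)
         (fun t => dg t * (rho t - f t / g t) / g t) 0 1); auto.
- intros t Ht. specialize (Hg t Ht).
  replace (dg t * (rho t - f t / g t) / g t)
    with ((rho t * dg t * g t - f t * dg t) / (g t ^ 2)) by (field; lra).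
  apply is_derive_div; auto. lra.
- intros t Ht. specialize (Hg t Ht).
  assert (f t / g t < rho t).
  { apply (lhopital_lt f g rho dg); auto. intros s Hs. apply Hr; lra. }
  apply Rdiv_lt_0_compat; [ | exact Hg ].
  apply Rmult_lt_0_compat; [ now apply dg_pos | lra ].
Qed.

(** * Complete elliptic integrals as functions of x = r^2 *)

Definition ell_Delta (x t : R) : R := sqrt (1 - x * sin t ^ 2).
Definition K_sq (x : R) : R := RInt (fun t => / ell_Delta x t) 0 (PI / 2).
Definition E_sq (x : R) : R := RInt (fun t => ell_Delta x t) 0 (PI / 2).

Lemma ellK_K_sq (r : R) : ellK r = K_sq (r ^ 2).
Proof. reflexivity. Qed.

Lemma ell_radicand_pos (x t : R) : x < 1 -> 0 < 1 - x * sin t ^ 2.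
Proof.
intros Hx. assert (H := sin2_cos2 t). unfold Rsqr in H.
assert (0 <= sin t ^ 2) by nra.
assert (sin t ^ 2 <= 1) by nra.
destruct (Rle_or_lt x 0); nra.
Qed.

Lemma ell_Delta_pos (x t : R) : x < 1 -> 0 < ell_Delta x t.
Proof. intros Hx. now apply sqrt_lt_R0, ell_radicand_pos. Qed.

Lemma ell_Delta_sqr (x t : R) : x < 1 -> ell_Delta x t * ell_Delta x t = 1 - x * sin t ^ 2.
Proof. intros Hx. apply sqrt_sqrt, Rlt_le. now apply ell_radicand_pos. Qed.

Lemma ell_Delta_derive_x (x t : R) :
  x < 1 -> is_derive (fun u => ell_Delta u t) x (- sin t ^ 2 / (2 * ell_Delta x t)).
Proof.
intros Hx. apply (is_derive_sqrt (fun u => 1 - u * sin t ^ 2)).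
- auto_derive; [ exact I | ring ].
- now apply ell_radicand_pos.
Qed.

Lemma ell_Delta_derive_t (x t : R) :
  x < 1 -> is_derive (ell_Delta x) t (- x * sin t * cos t / ell_Delta x t).
Proof.
intros Hx. assert (H' := ell_Delta_pos x t Hx).
replace (- x * sin t * cos t / ell_Delta x t)
  with (- (x * (2 * sin t * cos t)) / (2 * ell_Delta x t)) by (field; lra).
apply (is_derive_sqrt (fun t => 1 - x * sin t ^ 2)).
- auto_derive; [ exact I | ring ].
- now apply ell_radicand_pos.
Qed.

Lemma ell_Delta_continuous (x t : R) : x < 1 -> continuous (ell_Delta x) t.
Proof.
intros Hx. apply (ex_derive_continuous (ell_Delta x)).
eexists. now apply ell_Delta_derive_t.
Qed.

Lemma ell_Delta_inv_continuous (x t : R) : x < 1 -> continuous (fun t => / ell_Delta x t) t.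
Proof.
intros Hx. apply (ex_derive_continuous (fun t => / ell_Delta x t)).
eexists. apply is_derive_inv. now apply ell_Delta_derive_t.
apply Rgt_not_eq. now apply ell_Delta_pos.
Qed.

Lemma sin2_continuity_2d (x t : R) : continuity_2d_pt (fun _ s => sin s ^ 2) x t.
Proof.
apply (continuity_1d_2d_pt_comp (fun s => sin s ^ 2) (fun _ t => t)).
- apply derivable_continuous_pt. auto_derive_fun (fun s => sin s ^ 2).
  intros H. eexists. apply is_derive_Reals, H. exact I.
- apply continuity_2d_pt_id2.
Qed.

Lemma ell_Delta_continuity_2d (x t : R) : x < 1 -> continuity_2d_pt ell_Delta x t.
Proof.
intros Hx. apply (continuity_1d_2d_pt_comp sqrt (fun x t => 1 - x * sin t ^ 2)).
- apply continuity_pt_sqrt, Rlt_le. now apply ell_radicand_pos.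
- apply continuity_2d_pt_minus; [ apply continuity_2d_pt_const | ].
  apply continuity_2d_pt_mult; [ apply continuity_2d_pt_id1 | ].
  apply sin2_continuity_2d.
Qed.

Lemma ex_RInt_cont (f : R -> R) (a b : R) :
  (forall t, continuous f t) -> ex_RInt f a b.
Proof. intros H. apply (ex_RInt_continuous (V := R_CompleteNormedModule)). auto. Qed.

Lemma ex_RInt_ell_Delta (x : R) a b : x < 1 -> ex_RInt (ell_Delta x) a b.
Proof. intros Hx. apply ex_RInt_cont. intros. now apply ell_Delta_continuous. Qed.

Lemma ex_RInt_ell_Delta_inv (x : R) a b : x < 1 -> ex_RInt (fun t => / ell_Delta x t) a b.
Proof. intros Hx. apply ex_RInt_cont. intros. now apply ell_Delta_inv_continuous. Qed.

Lemma locally_lt_1 (x : R) (P : R -> Prop) :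
  x < 1 -> (forall y, y < 1 -> P y) -> locally x P.
Proof.
intros Hx H. apply filter_imp with (fun y => y < 1); [ exact H | ].
now apply (open_lt 1).
Qed.

Lemma is_derive_RInt_param_lt_1 (f df : R -> R -> R) (a b x : R) :
  (forall u t, u < 1 -> is_derive (fun u => f u t) u (df u t)) ->
  (forall u t, u < 1 -> continuity_2d_pt df u t) ->
  (forall u t, u < 1 -> continuous (f u) t) ->
  x < 1 -> is_derive (fun u => RInt (f u) a b) x (RInt (df x) a b).
Proof.
intros Hd H2 Hc Hx.
replace (RInt (df x) a b)
  with (RInt (fun t => Derive (fun u => f u t) x) a b).
2:{ apply RInt_ext. intros t _. apply is_derive_unique. now apply Hd. }
apply (is_derive_RInt_param f).
- apply locally_lt_1; [ exact Hx | ]. intros y Hy t _. eexists. now apply Hd.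
- intros t _. apply continuity_2d_pt_ext_loc with df; [ | now apply H2 ].
  exists (mkposreal (1 - x) ltac:(lra)). intros u v Hu _. simpl in *.
  apply Rabs_def2 in Hu.
  symmetry. apply is_derive_unique. apply Hd. lra.
- apply locally_lt_1; [ exact Hx | ]. intros y Hy. apply ex_RInt_cont.
  intros t. now apply Hc.
Qed.

(** With D = [ell_Delta x t], the integrand of the derivative is - sin^2 / (2 D) = (D - 1/D) / (2 x)
    pointwise, so no integration by parts is needed here. *)
Lemma E_sq_derive (x : R) :
  0 < x < 1 -> is_derive E_sq x ((E_sq x - K_sq x) / (2 * x)).
Proof.
intros Hx.
replace ((E_sq x - K_sq x) / (2 * x))
  with (RInt (fun t => - sin t ^ 2 * / (2 * ell_Delta x t)) 0 (PI / 2)).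
- apply (is_derive_RInt_param_lt_1 ell_Delta (fun x t => - sin t ^ 2 * / (2 * ell_Delta x t))).
  + intros. now apply ell_Delta_derive_x.
  + intros u t Hu. apply continuity_2d_pt_mult.
    * apply continuity_2d_pt_opp, sin2_continuity_2d.
    * apply continuity_2d_pt_inv.
      -- apply continuity_2d_pt_mult; [ apply continuity_2d_pt_const | ].
         now apply ell_Delta_continuity_2d.
      -- assert (H := ell_Delta_pos u t Hu). lra.
  + intros u t Hu. now apply ell_Delta_continuous.
  + lra.
- apply is_RInt_unique.
  apply is_RInt_ext with (fun t => scal (/ (2 * x)) (minus (ell_Delta x t) (/ ell_Delta x t))).
  + intros t _. unfold scal, minus, plus, opp; simpl; unfold mult; simpl.
    assert (H1 := ell_Delta_pos x t ltac:(lra)). assert (H2 := ell_Delta_sqr x t ltac:(lra)).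
    apply (Rmult_eq_reg_r (2 * x * ell_Delta x t)); [ | nra ].
    field_simplify; [ | lra | lra ]. simpl in *. lra.
  + replace ((E_sq x - K_sq x) / (2 * x)) with (scal (/ (2 * x)) (minus (E_sq x) (K_sq x))).
    2:{ unfold scal, minus, plus, opp; simpl; unfold mult; simpl. field. lra. }
    apply (is_RInt_scal (V := R_NormedModule)).
    apply (is_RInt_minus (V := R_NormedModule)); apply (RInt_correct (V := R_CompleteNormedModule)).
    * apply ex_RInt_ell_Delta. lra.
    * apply ex_RInt_ell_Delta_inv. lra.
Qed.

(* With D = ell_Delta x t, 2 x (1 - x) d/dx (1/D) = D - (1 - x)/D - x d/dt (sin t cos t / D), and the
   last term integrates to 0. *)
Lemma K_sq_derive (x : R) :
  0 < x < 1 ->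
  is_derive K_sq x ((E_sq x - (1 - x) * K_sq x) / (2 * x * (1 - x))).
Proof.
intros Hx.
replace ((E_sq x - (1 - x) * K_sq x) / (2 * x * (1 - x)))
  with (RInt (fun t => sin t ^ 2 * / (2 * ell_Delta x t * ell_Delta x t * ell_Delta x t)) 0 (PI / 2)).
- apply (is_derive_RInt_param_lt_1 (fun x t => / ell_Delta x t)
           (fun x t => sin t ^ 2 * / (2 * ell_Delta x t * ell_Delta x t * ell_Delta x t))).
  + intros u t Hu. assert (H := ell_Delta_pos u t Hu).
    replace (sin t ^ 2 * / (2 * ell_Delta u t * ell_Delta u t * ell_Delta u t))
      with (- (- sin t ^ 2 / (2 * ell_Delta u t)) / (ell_Delta u t) ^ 2) by (field; lra).
    apply (is_derive_inv (fun u => ell_Delta u t)); [ now apply ell_Delta_derive_x | lra ].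
  + intros u t Hu. assert (H := ell_Delta_pos u t Hu).
    assert (HD := ell_Delta_continuity_2d u t Hu).
    apply continuity_2d_pt_mult; [ apply sin2_continuity_2d | ].
    apply continuity_2d_pt_inv.
    * repeat apply continuity_2d_pt_mult; auto. apply continuity_2d_pt_const.
    * repeat apply Rmult_integral_contrapositive_currified; lra.
  + intros u t Hu. now apply ell_Delta_inv_continuous.
  + lra.
- set (phi := fun t => sin t * cos t / ell_Delta x t).
  set (dphi := fun t => (1 - 2 * sin t ^ 2 + x * sin t ^ 4)
                        / (ell_Delta x t * ell_Delta x t * ell_Delta x t)).
  assert (Hphi : is_RInt dphi 0 (PI / 2) 0).
  { replace 0 with (minus (phi (PI / 2)) (phi 0)) at 2.
    2:{ unfold phi, minus, plus, opp; simpl. rewrite cos_PI2, sin_0. unfold Rdiv. ring. }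
    apply (is_RInt_derive (V := R_CompleteNormedModule) phi dphi).
    - intros t _. assert (H1 := ell_Delta_pos x t ltac:(lra)).
      assert (H2 := ell_Delta_sqr x t ltac:(lra)).
      assert (H3 := sin2_cos2 t). unfold Rsqr in H3.
      replace (dphi t) with
        (((cos t * cos t - sin t * sin t) * ell_Delta x t
          - (sin t * cos t) * (- x * sin t * cos t / ell_Delta x t)) / (ell_Delta x t ^ 2)).
      + apply (is_derive_div (fun t => sin t * cos t) (ell_Delta x)).
        * auto_derive; [ exact I | ring ].
        * apply ell_Delta_derive_t. lra.
        * lra.
      + unfold dphi.
        replace ((cos t * cos t - sin t * sin t) * ell_Delta x t -
            sin t * cos t * (- x * sin t * cos t / ell_Delta x t))
          with (((cos t * cos t - sin t * sin t) * (ell_Delta x t * ell_Delta x t)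
            + x * (sin t * sin t) * (cos t * cos t)) / ell_Delta x t) by (field; lra).
        replace ((cos t * cos t - sin t * sin t) * (ell_Delta x t * ell_Delta x t)
            + x * (sin t * sin t) * (cos t * cos t))
          with (1 - 2 * sin t ^ 2 + x * sin t ^ 4); [ field; lra | ].
        rewrite H2. replace (cos t * cos t) with (1 - sin t * sin t) by lra. ring.
    - intros t _. assert (H1 := ell_Delta_pos x t ltac:(lra)).
      apply (ex_derive_continuous dphi).
      assert (HD : ex_derive (ell_Delta x) t) by (eexists; apply ell_Delta_derive_t; lra).
      unfold dphi. apply ex_derive_div.
      + auto_derive. exact I.
      + apply (ex_derive_mult (fun t => ell_Delta x t * ell_Delta x t)); [ | exact HD ].
        now apply (ex_derive_mult (ell_Delta x)).
      + repeat apply Rmult_integral_contrapositive_currified; lra. }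
  apply is_RInt_unique.
  apply is_RInt_ext with (fun t => scal (/ (2 * x * (1 - x)))
    (minus (minus (ell_Delta x t) (scal (1 - x) (/ ell_Delta x t))) (scal x (dphi t)))).
  + intros t _. unfold scal, minus, plus, opp; simpl; unfold mult; simpl. unfold dphi.
    assert (H1 := ell_Delta_pos x t ltac:(lra)). assert (H2 := ell_Delta_sqr x t ltac:(lra)).
    apply (Rmult_eq_reg_r (2 * x * (1 - x) * (ell_Delta x t * ell_Delta x t * ell_Delta x t))).
    2:{ repeat apply Rmult_integral_contrapositive_currified; lra. }
    transitivity ((ell_Delta x t * ell_Delta x t) * (ell_Delta x t * ell_Delta x t)
      - (1 - x) * (ell_Delta x t * ell_Delta x t) - x * (1 - 2 * sin t ^ 2 + x * sin t ^ 4)).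
    { field. lra. }
    transitivity (x * (1 - x) * sin t ^ 2); [ rewrite H2; ring | field; lra ].
  + replace ((E_sq x - (1 - x) * K_sq x) / (2 * x * (1 - x)))
      with (scal (/ (2 * x * (1 - x)))
              (minus (minus (E_sq x) (scal (1 - x) (K_sq x))) (scal x 0))).
    2:{ unfold scal, minus, plus, opp; simpl; unfold mult; simpl. field. lra. }
    apply (is_RInt_scal (V := R_NormedModule)).
    apply (is_RInt_minus (V := R_NormedModule)).
    * apply (is_RInt_minus (V := R_NormedModule)).
      -- apply (RInt_correct (V := R_CompleteNormedModule)), ex_RInt_ell_Delta. lra.
      -- apply (is_RInt_scal (V := R_NormedModule)).
         apply (RInt_correct (V := R_CompleteNormedModule)), ex_RInt_ell_Delta_inv. lra.
    * now apply (is_RInt_scal (V := R_NormedModule)).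
Qed.

(** * Elementary bounds on the complete integrals *)

Lemma is_RInt_K_sq (x : R) : x < 1 -> is_RInt (fun t => / ell_Delta x t) 0 (PI / 2) (K_sq x).
Proof.
intros Hx. apply (RInt_correct (V := R_CompleteNormedModule)).
now apply ex_RInt_ell_Delta_inv.
Qed.

Lemma is_RInt_E_sq (x : R) : x < 1 -> is_RInt (ell_Delta x) 0 (PI / 2) (E_sq x).
Proof.
intros Hx. apply (RInt_correct (V := R_CompleteNormedModule)).
now apply ex_RInt_ell_Delta.
Qed.

Lemma PI2_ge_0 : 0 <= PI / 2.
Proof. assert (H := PI_RGT_0). lra. Qed.

Lemma E_sq_ge_1 (x : R) : 0 < x < 1 -> 1 <= E_sq x.
Proof.
intros Hx. assert (HE := is_RInt_E_sq x ltac:(lra)).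
apply (is_RInt_le cos (ell_Delta x) 0 (PI / 2)); [ apply PI2_ge_0 | | exact HE | ].
- replace 1 with (minus (sin (PI / 2)) (sin 0)).
  2:{ unfold minus, plus, opp; simpl. rewrite sin_PI2, sin_0. ring. }
  apply (is_RInt_derive (V := R_CompleteNormedModule) sin cos).
  + intros t _. auto_derive; [ exact I | ring ].
  + intros t _. apply (ex_derive_continuous cos). auto_derive. exact I.
- intros t Ht. assert (Hc : 0 < cos t) by (apply cos_gt_0; lra).
  assert (H := sin2_cos2 t). unfold Rsqr in H.
  rewrite <- (sqrt_square (cos t)) by lra.
  apply sqrt_le_1_alt. nra.
Qed.

Lemma ell_Delta_le_1 (x t : R) : 0 < x < 1 -> ell_Delta x t <= 1.
Proof.
intros Hx. rewrite <- sqrt_1. apply sqrt_le_1_alt.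
assert (0 <= sin t ^ 2) by nra. nra.
Qed.

(** With D = [ell_Delta x t], these are the integrals of D <= 1/D <= D + x/D, the second being 1 <=
    D^2 + x. They make K/E - 1 of order x at 0. *)
Lemma K_sq_le_E_sq_add (x : R) : 0 < x < 1 -> E_sq x <= K_sq x <= E_sq x + x * K_sq x.
Proof.
intros Hx.
assert (HK := is_RInt_K_sq x ltac:(lra)). assert (HE := is_RInt_E_sq x ltac:(lra)).
assert (Hp : forall t, 0 < ell_Delta x t) by (intros t; apply ell_Delta_pos; lra).
split.
- apply (is_RInt_le (ell_Delta x) (fun t => / ell_Delta x t) 0 (PI / 2));
    [ apply PI2_ge_0 | exact HE | exact HK | ].
  intros t _. specialize (Hp t). assert (H1 := ell_Delta_le_1 x t Hx).
  apply Rle_trans with 1; [ exact H1 | ]. rewrite <- Rinv_1. now apply Rinv_le_contravar.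
- apply (is_RInt_le (fun t => / ell_Delta x t) (fun t => plus (ell_Delta x t) (scal x (/ ell_Delta x t)))
           0 (PI / 2)); [ apply PI2_ge_0 | exact HK | | ].
  + apply (is_RInt_plus (V := R_NormedModule)); [ exact HE | ].
    now apply (is_RInt_scal (V := R_NormedModule)).
  + intros t _. specialize (Hp t). assert (H2 := ell_Delta_sqr x t ltac:(lra)).
    unfold plus, scal; simpl; unfold mult; simpl.
    assert (H := sin2_cos2 t). unfold Rsqr in H.
    apply (Rmult_le_reg_r (ell_Delta x t)); [ exact Hp | ].
    rewrite Rmult_plus_distr_r, H2, Rmult_assoc, Rinv_l by lra. nra.
Qed.

Lemma K_sq_le_bound (x : R) : 0 < x < 1 -> K_sq x <= PI / 2 / sqrt (1 - x).
Proof.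
intros Hx. assert (HK := is_RInt_K_sq x ltac:(lra)).
assert (Hs : 0 < sqrt (1 - x)) by (apply sqrt_lt_R0; lra).
apply (is_RInt_le (fun t => / ell_Delta x t) (fun _ => / sqrt (1 - x)) 0 (PI / 2));
  [ apply PI2_ge_0 | exact HK | | ].
- replace (PI / 2 / sqrt (1 - x)) with (scal (PI / 2 - 0) (/ sqrt (1 - x))).
  2:{ unfold scal; simpl; unfold mult; simpl. field. lra. }
  apply (is_RInt_const (V := R_NormedModule)).
- intros t _. apply Rinv_le_contravar; [ exact Hs | ].
  apply sqrt_le_1_alt. assert (H := sin2_cos2 t). unfold Rsqr in H. nra.
Qed.

Lemma K_sq_ge_PI2 (x : R) : 0 < x < 1 -> PI / 2 <= K_sq x.
Proof.
intros Hx. assert (HK := is_RInt_K_sq x ltac:(lra)).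
apply (is_RInt_le (fun _ => 1) (fun t => / ell_Delta x t) 0 (PI / 2));
  [ apply PI2_ge_0 | | exact HK | ].
- replace (PI / 2) with (scal (PI / 2 - 0) 1) at 2.
  2:{ unfold scal; simpl; unfold mult; simpl. field. }
  apply (is_RInt_const (V := R_NormedModule)).
- intros t _. rewrite <- Rinv_1. apply Rinv_le_contravar.
  + apply ell_Delta_pos. lra.
  + now apply ell_Delta_le_1.
Qed.

(** * The function arth r / r in the variable x, and its distance to K *)

Definition A_sq (x : R) : R := arth (sqrt x) / sqrt x.

Lemma sqrt_01 (x : R) : 0 < x < 1 -> 0 < sqrt x < 1 /\ sqrt x * sqrt x = x.
Proof.
intros Hx. split; [ split | ].
- apply sqrt_lt_R0. lra.
- rewrite <- sqrt_1. apply sqrt_lt_1_alt. lra.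
- apply sqrt_sqrt. lra.
Qed.

Lemma arth_derive (r : R) : 0 < r < 1 -> is_derive arth r (/ (1 - r ^ 2)).
Proof.
intros Hr. unfold arth. auto_derive.
- repeat split; try lra. apply Rdiv_lt_0_compat; lra.
- field. repeat split; nra.
Qed.

Lemma A_sq_derive (x : R) :
  0 < x < 1 -> is_derive A_sq x ((/ (1 - x) - A_sq x) / (2 * x)).
Proof.
intros Hx. destruct (sqrt_01 x Hx) as [Hs Hs2].
assert (Hd : is_derive sqrt x (/ (2 * sqrt x))).
{ auto_derive; [ lra | field; lra ]. }
replace ((/ (1 - x) - A_sq x) / (2 * x))
  with ((/ (2 * sqrt x) * / (1 - sqrt x ^ 2) * sqrt x - arth (sqrt x) * / (2 * sqrt x))
        / sqrt x ^ 2).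
- unfold A_sq. apply (is_derive_div (fun x => arth (sqrt x)) sqrt); [ | exact Hd | lra ].
  apply (is_derive_comp arth sqrt); [ now apply arth_derive | exact Hd ].
- unfold A_sq. set (a := arth (sqrt x)). set (s := sqrt x) in *. rewrite <- Hs2.
  field. repeat split; nra.
Qed.

(* K_sq x - A_sq x is the integral of (1 - sin) / ell_Delta x, which ell_Delta x >= sqrt x * cos bounds
   by that of cos / (1 + sin) / sqrt x. *)
Lemma K_sq_A_sq_bounds (x : R) : 0 < x < 1 -> A_sq x <= K_sq x <= A_sq x + ln 2 / sqrt x.
Proof.
intros Hx. assert (HK := is_RInt_K_sq x ltac:(lra)).
destruct (sqrt_01 x Hx) as [Hs Hs2]. set (r := sqrt x) in *.
assert (Hp : forall t, 0 < ell_Delta x t) by (intros t; apply ell_Delta_pos; lra).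
(* The absolute value makes this valid for every real t, so the logarithm in [Phi] below has a
   positive argument everywhere. *)
assert (Hcs : forall t, r * Rabs (cos t) < ell_Delta x t).
{ intros t. apply Rsqr_incrst_0.
  - unfold Rsqr. rewrite ell_Delta_sqr by lra.
    replace (r * Rabs (cos t) * (r * Rabs (cos t)))
      with ((r * r) * (Rabs (cos t) * Rabs (cos t))) by ring.
    rewrite <- Rabs_mult, Rabs_pos_eq by nra.
    assert (H := sin2_cos2 t). unfold Rsqr in H. rewrite Hs2. nra.
  - apply Rmult_le_pos; [ lra | apply Rabs_pos ].
  - apply Rlt_le, Hp. }
assert (Hpc : forall t, 0 < r * cos t + ell_Delta x t).
{ intros t. specialize (Hcs t). assert (H := Rle_abs (- cos t)). rewrite Rabs_Ropp in H. nra. }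
assert (HA : is_RInt (fun t => sin t / ell_Delta x t) 0 (PI / 2) (A_sq x)).
(* An antiderivative of sin / D for D = [ell_Delta x t]; its increment is (ln (1 + r) - ln (sqrt (1
   - r^2))) / r = arth r / r. *)
{ set (Phi := fun t => / r * - ln (r * cos t + ell_Delta x t)).
  replace (A_sq x) with (minus (Phi (PI / 2)) (Phi 0)).
  - apply (is_RInt_derive (V := R_CompleteNormedModule) Phi (fun t => sin t / ell_Delta x t)).
    + intros t _. specialize (Hp t). specialize (Hpc t).
      replace (sin t / ell_Delta x t) with
        (/ r * - ((- r * sin t + - x * sin t * cos t / ell_Delta x t) * / (r * cos t + ell_Delta x t))).
      * unfold Phi.
        apply is_derive_scal. apply (is_derive_opp (fun t => ln (r * cos t + ell_Delta x t))).
        apply (is_derive_comp ln (fun t => r * cos t + ell_Delta x t)).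
        { now apply is_derive_ln. }
        apply (is_derive_plus (fun t => r * cos t) (ell_Delta x)).
        { auto_derive; [ exact I | ring ]. }
        apply ell_Delta_derive_t. lra.
      * set (D := ell_Delta x t) in *. rewrite <- Hs2. field. lra.
    + intros t _. apply (continuous_mult sin (fun t => / ell_Delta x t)).
      * apply (ex_derive_continuous sin). auto_derive. exact I.
      * apply ell_Delta_inv_continuous. lra.
  - unfold Phi, minus, plus, opp; simpl. unfold ell_Delta.
    rewrite cos_PI2, sin_PI2, cos_0, sin_0.
    replace (r * 0 + sqrt (1 - x * 1 ^ 2)) with (sqrt (1 - x)) by (rewrite Rmult_0_r, Rplus_0_l; f_equal; ring).
    replace (1 - x * 0 ^ 2) with 1 by ring. rewrite sqrt_1, Rmult_1_r.
    unfold A_sq, arth. fold r. rewrite ln_div by lra.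
    assert (H1 : ln (1 - x) = 2 * ln (sqrt (1 - x))).
    { rewrite <- (sqrt_sqrt (1 - x)) at 1 by lra.
      rewrite ln_mult by (apply sqrt_lt_R0; lra). ring. }
    assert (H2 : ln (1 - x) = ln (1 - r) + ln (1 + r)).
    { rewrite <- ln_mult by lra. f_equal. rewrite <- Hs2. ring. }
    replace (ln (r + 1)) with (ln (1 + r)) by (f_equal; ring).
    apply (Rmult_eq_reg_r (2 * r)); [ | lra ]. field_simplify; [ | lra | lra ]. lra. }
split.
- apply (is_RInt_le (fun t => sin t / ell_Delta x t) (fun t => / ell_Delta x t) 0 (PI / 2));
    [ apply PI2_ge_0 | exact HA | exact HK | ].
  intros t _. specialize (Hp t). assert (H := SIN_bound t).
  assert (0 < / ell_Delta x t) by now apply Rinv_0_lt_compat. unfold Rdiv. nra.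
- apply (is_RInt_le (fun t => / ell_Delta x t)
     (fun t => plus (sin t / ell_Delta x t) (scal (/ r) (cos t / (1 + sin t)))) 0 (PI / 2));
    [ apply PI2_ge_0 | exact HK | | ].
  + apply (is_RInt_plus (V := R_NormedModule)); [ exact HA | ].
    replace (ln 2 / r) with (scal (/ r) (ln 2))
      by (unfold scal; simpl; unfold mult; simpl; field; lra).
    apply (is_RInt_scal (V := R_NormedModule)).
    replace (ln 2) with (minus (ln (1 + sin (PI / 2))) (ln (1 + sin 0))).
    2:{ unfold minus, plus, opp; simpl. rewrite sin_PI2, sin_0, Rplus_0_r, ln_1.
        rewrite Ropp_0, Rplus_0_r. f_equal; ring. }
    assert (Hsin : forall t, Rmin 0 (PI / 2) <= t <= Rmax 0 (PI / 2) -> 0 <= sin t).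
    { assert (H := PI2_ge_0). intros t. rewrite Rmin_left, Rmax_right by lra.
      intros Ht. apply sin_ge_0; lra. }
    apply (is_RInt_derive (V := R_CompleteNormedModule) (fun t => ln (1 + sin t))).
    * intros t Ht. specialize (Hsin t Ht). auto_derive; [ lra | field; lra ].
    * intros t Ht. specialize (Hsin t Ht).
      apply (ex_derive_continuous (fun t => cos t / (1 + sin t))). auto_derive. lra.
  + intros t Ht. specialize (Hp t). specialize (Hcs t).
    assert (Hc : 0 < cos t) by (apply cos_gt_0; lra).
    assert (H1 : 0 <= sin t) by (apply sin_ge_0; lra).
    assert (H2 := sin2_cos2 t). unfold Rsqr in H2.
    rewrite Rabs_pos_eq in Hcs by lra.
    unfold plus, scal; simpl; unfold mult; simpl.
    apply (Rmult_le_reg_r (ell_Delta x t * r * (1 + sin t))).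
    { repeat apply Rmult_lt_0_compat; lra. }
    replace (/ ell_Delta x t * (ell_Delta x t * r * (1 + sin t))) with (r * (1 + sin t)) by (field; lra).
    replace ((sin t / ell_Delta x t + / r * (cos t / (1 + sin t))) * (ell_Delta x t * r * (1 + sin t)))
      with (sin t * r * (1 + sin t) + cos t * ell_Delta x t) by (field; lra).
    assert (r * (1 + sin t) - sin t * r * (1 + sin t) = r * cos t * cos t).
    { transitivity (r * (1 - sin t * sin t)); [ ring | ].
      replace (1 - sin t * sin t) with (cos t * cos t) by lra. ring. }
    assert (cos t * (r * cos t) <= cos t * ell_Delta x t) by (apply Rmult_le_compat_l; lra).
    lra.
Qed.

(** * Riccati equations *)

(* The bound D x >= - M x stands for D 0 >= 0, as the equations to which this applies are singular at 0. *)
Lemma comparison_nonneg (D dD : R -> R) (b C M : R) :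
  0 <= C -> 0 <= M ->
  (forall x, 0 < x <= b -> is_derive D x (dD x)) ->
  (forall x, 0 < x <= b -> - M * x <= D x) ->
  (forall x, 0 < x <= b -> D x < 0 -> C * D x <= dD x) ->
  forall x, 0 < x <= b -> 0 <= D x.
Proof.
intros HC HM Hd H0 Hc x1 Hx1.
destruct (Rle_or_lt 0 (D x1)) as [H | Hneg]; [ exact H | exfalso ].
(* The supremum [tau] of [P] is the last point before [x1] where D >= 0, or 0. Beyond it D is
   negative, so exp (- C t) D is nondecreasing up to its negative value at [x1]; both cases for
   [tau] contradict this. *)
set (P := fun t => 0 <= t <= x1 /\ (t = 0 \/ 0 <= D t)).
destruct (completeness P) as [tau [Hub Hlub]].
{ exists x1. intros t [Ht _]. lra. }
{ exists 0. split; [ lra | now left ]. }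
assert (Ht0 : 0 <= tau) by (apply Hub; split; [ lra | now left ]).
assert (Ht1 : tau <= x1) by (apply Hlub; intros t [Ht _]; lra).
assert (Hafter : forall t, tau < t <= x1 -> D t < 0).
{ intros t Ht. destruct (Rlt_or_le (D t) 0) as [H | H]; [ exact H | exfalso ].
  assert (t <= tau) by (apply Hub; split; [ lra | now right ]). lra. }
set (E := fun t => exp (- C * t) * D t).
assert (HE : forall t, 0 < t <= b -> is_derive E t (exp (- C * t) * (dD t - C * D t))).
{ intros t Ht. unfold E.
  replace (exp (- C * t) * (dD t - C * D t))
    with (- C * exp (- C * t) * D t + exp (- C * t) * dD t) by ring.
  apply (is_derive_mult (fun t => exp (- C * t)) D).
  - auto_derive; [ exact I | ring ].
  - now apply Hd.
  - intros; apply Rmult_comm. }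
assert (Hmono : forall s, tau <= s -> 0 < s -> s < x1 -> E s <= E x1).
{ intros s Hs Hs0 Hs1. destruct (MVT_cor2 E (fun t => exp (- C * t) * (dD t - C * D t)) s x1 Hs1) as [c [Hc1 Hc2]].
  { intros c Hc1. apply is_derive_Reals, HE. lra. }
  assert (HDc : D c < 0) by (apply Hafter; lra).
  specialize (Hc c ltac:(lra) HDc). assert (Hexp := exp_pos (- C * c)).
  assert (0 <= exp (- C * c) * (dD c - C * D c)) by (apply Rmult_le_pos; lra).
  nra. }
assert (HEx1 : E x1 < 0).
{ unfold E. assert (Hexp := exp_pos (- C * x1)). nra. }
destruct (Req_dec tau 0) as [Hz | Hz].
(* Case tau = 0: [s] is so small that the bound D s >= - M s gives E s > E x1. *)
- set (s := Rmin (x1 / 2) (- E x1 / (2 * (M + 1)))).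
  assert (Hp : 0 < - E x1 / (2 * (M + 1))) by (apply Rdiv_lt_0_compat; lra).
  assert (Hs : 0 < s < x1).
  { unfold s. split; [ apply Rmin_glb_lt; lra | ].
    apply Rle_lt_trans with (1 := Rmin_l _ _). lra. }
  assert (Hs2 : s * (2 * (M + 1)) <= - E x1).
  { apply Rle_trans with (- E x1 / (2 * (M + 1)) * (2 * (M + 1))).
    - apply Rmult_le_compat_r; [ lra | apply Rmin_r ].
    - right. field. lra. }
  assert (H1 := Hmono s ltac:(lra) ltac:(lra) ltac:(lra)).
  assert (H2 := H0 s ltac:(lra)). unfold E at 1 in H1.
  assert (He1 : 0 < exp (- C * s) <= 1).
  { split; [ apply exp_pos | ]. rewrite <- exp_0.
    destruct (Req_dec (C * s) 0) as [H | H].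
    - right. f_equal. lra.
    - left. apply exp_increasing. assert (0 <= C * s) by (apply Rmult_le_pos; lra). lra. }
  nra.
- assert (HDt : 0 <= D tau).
  { destruct (Rle_or_lt 0 (D tau)) as [H | H]; [ exact H | exfalso ].
    assert (Hct : continuous D tau).
    { apply (ex_derive_continuous D). eexists. apply Hd. lra. }
    assert (Hloc : locally tau (fun t => D t < 0)).
    { apply (Hct (fun y => y < 0)). now apply (open_lt 0). }
    destruct Hloc as [d Hd2].
    assert (tau <= Rmax (tau / 2) (tau - d / 2)).
    { apply Hlub. intros t [Ht HP].
      destruct (Rle_or_lt t (Rmax (tau / 2) (tau - d / 2))) as [Ha | Ha]; [ exact Ha | exfalso ].
      assert (Hm1 := Rmax_l (tau / 2) (tau - d / 2)).
      assert (Hm2 := Rmax_r (tau / 2) (tau - d / 2)).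
      destruct HP as [HP | HP]; [ lra | ].
      destruct (Rlt_or_le tau t) as [Hb | Hb].
      - specialize (Hafter t ltac:(lra)). lra.
      - assert (HDt : D t < 0); [ | lra ].
        apply Hd2. change (Rabs (t - tau) < d). assert (Hd3 := cond_pos d).
        apply Rabs_def1; lra. }
    assert (Rmax (tau / 2) (tau - d / 2) < tau); [ | lra ].
    assert (Hd3 := cond_pos d). apply Rmax_lub_lt; lra. }
  destruct (Req_dec tau x1) as [He | He]; [ rewrite He in HDt; lra | ].
  assert (H1 := Hmono tau ltac:(lra) ltac:(lra) ltac:(lra)).
  assert (0 <= E tau); [ | lra ].
  unfold E. apply Rmult_le_pos; [ apply Rlt_le, exp_pos | exact HDt ].
Qed.

(** [Zx] and [Wx] vanish at 0 and have positive Taylor coefficients, unlike 1/A and E/K. Nonnegative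
    arguments are what allows lower and upper bounds to be substituted term by term into a
    polynomial. *)
Definition Zx (x : R) : R := A_sq x - 1.
Definition Wx (x : R) : R := K_sq x / E_sq x - 1.

Lemma Zx_derive (x : R) :
  0 < x < 1 -> is_derive Zx x ((x / (1 - x) - Zx x) / (2 * x)).
Proof.
intros Hx.
replace ((x / (1 - x) - Zx x) / (2 * x)) with (minus ((/ (1 - x) - A_sq x) / (2 * x)) 0).
- apply (is_derive_minus A_sq (fun _ => 1)); [ now apply A_sq_derive | ].
  apply (is_derive_const (K := R_AbsRing) (V := R_NormedModule)).
- unfold Zx, minus, plus, opp; simpl. field. lra.
Qed.

(** The derivatives of K and E are linear in K and E, so their quotient satisfies a Riccati
    equation. It yields the recursion 2 n w_n = 1 + sum of w_i w_(n-i) for the Taylor coefficients,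
    as the equation of [Zx] yields (2 n + 1) z_n = 1. *)
Lemma Wx_derive (x : R) :
  0 < x < 1 -> is_derive Wx x ((x / (1 - x) + Wx x ^ 2) / (2 * x)).
Proof.
intros Hx. assert (HE := E_sq_ge_1 x Hx).
replace ((x / (1 - x) + Wx x ^ 2) / (2 * x))
  with (minus (((E_sq x - (1 - x) * K_sq x) / (2 * x * (1 - x)) * E_sq x
               - K_sq x * ((E_sq x - K_sq x) / (2 * x))) / E_sq x ^ 2) 0).
- apply (is_derive_minus (fun x => K_sq x / E_sq x) (fun _ => 1)).
  + apply is_derive_div; [ now apply K_sq_derive | now apply E_sq_derive | lra ].
  + apply (is_derive_const (K := R_AbsRing) (V := R_NormedModule)).
- unfold Wx, minus, plus, opp; simpl. field. lra.
Qed.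

Lemma Wx_bounds (x : R) : 0 < x < 1 -> 0 <= Wx x <= x * K_sq x.
Proof.
intros Hx. assert (HE := E_sq_ge_1 x Hx). destruct (K_sq_le_E_sq_add x Hx) as [H1 H2].
assert (HEK : Wx x * E_sq x = K_sq x - E_sq x) by (unfold Wx; field; lra).
assert (0 <= x * K_sq x) by (apply Rmult_le_pos; lra).
split.
- destruct (Rle_or_lt 0 (Wx x)) as [H3 | H3]; [ exact H3 | nra ].
- destruct (Rle_or_lt (Wx x) (x * K_sq x)) as [H3 | H3]; [ exact H3 | nra ].
Qed.

Lemma at_right_of_ex_derive (f : R -> R) (a : R) :
  ex_derive f a -> filterlim f (at_right a) (locally (f a)).
Proof.
intros H. apply filterlim_filter_le_1 with (2 := ex_derive_continuous f a H).
apply filter_le_within.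
Qed.

Lemma arth_0 : arth 0 = 0.
Proof. unfold arth. replace ((1 + 0) / (1 - 0)) with 1 by field. rewrite ln_1. field. Qed.

(** This is s < arth s < s / (1 - s^2) at s = sqrt x; both follow by comparing derivatives. *)
Lemma Zx_bounds (x : R) : 0 < x < 1 -> 0 < Zx x < x / (1 - x).
Proof.
intros Hx. destruct (sqrt_01 x Hx) as [Hs Hs2]. set (r := sqrt x) in *.
assert (H1 : forall s, 0 < s < 1 -> 0 < arth s - s).
{ apply (deriv_pos_pos _ (fun s => / (1 - s ^ 2) - 1)).
  - replace 0 with (arth 0 - 0) at 2 by (rewrite arth_0; ring).
    apply (at_right_of_ex_derive (fun s => arth s - s)). unfold arth. auto_derive.
    repeat split; try lra. apply Rdiv_lt_0_compat; lra.
  - intros t Ht. apply (is_derive_minus arth (fun s => s)); [ now apply arth_derive | ].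
    apply (is_derive_id (K := R_AbsRing)).
  - intros t Ht. assert (/ 1 < / (1 - t ^ 2)); [ | lra ]. apply Rinv_lt_contravar; nra. }
assert (H2 : forall s, 0 < s < 1 -> 0 < s / (1 - s ^ 2) - arth s).
{ apply (deriv_pos_pos _ (fun s => (1 + s ^ 2) / (1 - s ^ 2) ^ 2 - / (1 - s ^ 2))).
  - replace 0 with (0 / (1 - 0 ^ 2) - arth 0) at 2 by (rewrite arth_0; field).
    apply (at_right_of_ex_derive (fun s => s / (1 - s ^ 2) - arth s)).
    unfold arth. auto_derive. repeat split; try lra. apply Rdiv_lt_0_compat; lra.
  - intros t Ht. apply (is_derive_minus (fun s => s / (1 - s ^ 2)) arth);
      [ | now apply arth_derive ].
    auto_derive; [ nra | field; nra ].
  - intros t Ht. assert (0 < 1 - t ^ 2) by nra.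
    replace ((1 + t ^ 2) / (1 - t ^ 2) ^ 2 - / (1 - t ^ 2))
      with (2 * t ^ 2 / (1 - t ^ 2) ^ 2) by (field; lra).
    apply Rdiv_lt_0_compat; nra. }
specialize (H1 r Hs). specialize (H2 r Hs).
assert (HA : A_sq x * r = arth r) by (unfold A_sq; fold r; field; lra).
assert (Hr2 : r / (1 - r ^ 2) = r * (1 + x / (1 - x))).
{ rewrite <- Hs2. field. nra. }
rewrite Hr2 in H2. unfold Zx. split; nra.
Qed.

(** * Taylor bounds *)

(** Integer coefficients, constant term first: the sign of a polynomial on (0, 9/10] becomes a
    closed computation in [Z], left to [vm_compute]. *)
Fixpoint pev (p : list Z) (x : R) : R :=
  match p with [] => 0 | c :: q => IZR c + x * pev q x end.

Fixpoint padd (p q : list Z) : list Z :=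
  match p, q with
  | [], _ => q
  | _, [] => p
  | a :: p', b :: q' => (a + b)%Z :: padd p' q'
  end.

Definition pscal (a : Z) (p : list Z) : list Z := map (Z.mul a) p.

Fixpoint pmul (p q : list Z) : list Z :=
  match p with [] => [] | a :: p' => padd (pscal a q) (0%Z :: pmul p' q) end.

Fixpoint pder (p : list Z) : list Z :=
  match p with [] => [] | _ :: q => padd q (0%Z :: pder q) end.

Fixpoint ppow (p : list Z) (n : nat) : list Z :=
  match n with O => [1%Z] | S n => pmul p (ppow p n) end.

Lemma pev_padd (p q : list Z) (x : R) : pev (padd p q) x = pev p x + pev q x.
Proof.
revert q; induction p as [ | a p IH]; intros [ | b q]; simpl; try ring.
rewrite plus_IZR, IH. ring.
Qed.

Lemma pev_pscal (a : Z) (p : list Z) (x : R) : pev (pscal a p) x = IZR a * pev p x.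
Proof.
induction p as [ | b p IH]; simpl; [ ring | ]. rewrite mult_IZR.
change (map (Z.mul a) p) with (pscal a p). rewrite IH. ring.
Qed.

Lemma pev_pmul (p q : list Z) (x : R) : pev (pmul p q) x = pev p x * pev q x.
Proof.
induction p as [ | a p IH]; simpl; [ ring | ].
rewrite pev_padd, pev_pscal. simpl. rewrite IH. ring.
Qed.

Lemma pev_ppow (p : list Z) (n : nat) (x : R) : pev (ppow p n) x = pev p x ^ n.
Proof.
induction n as [ | n IH]; simpl; [ ring | ]. rewrite pev_pmul, IH. ring.
Qed.

Lemma pev_derive (p : list Z) (x : R) : is_derive (pev p) x (pev (pder p) x).
Proof.
induction p as [ | a p IH]; simpl.
- apply (is_derive_const (K := R_AbsRing) (V := R_NormedModule)).
- rewrite pev_padd. simpl.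
  replace (pev p x + (0 + x * pev (pder p) x))
    with (plus 0 (1 * pev p x + x * pev (pder p) x)) by (unfold plus; simpl; ring).
  apply (is_derive_plus (fun _ => IZR a) (fun x => x * pev p x)).
  + apply (is_derive_const (K := R_AbsRing) (V := R_NormedModule)).
  + apply (is_derive_mult (fun x => x) (pev p)); [ | exact IH | ].
    * apply (is_derive_id (K := R_AbsRing)).
    * intros; apply Rmult_comm.
Qed.

(* A lower bound over [0, 9/10]: the value of a tail is replaced by 0 if it is nonnegative, and taken at
   9/10 (rounded down) otherwise. *)
Fixpoint plow (p : list Z) : Z :=
  match p with [] => 0 | c :: q => c + Z.min 0 (9 * plow q / 10) end%Z.

Lemma plow_le (p : list Z) (x : R) : 0 <= x <= 9 / 10 -> IZR (plow p) <= pev p x.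
Proof.
intros Hx. induction p as [ | c q IH]; [ simpl; lra | ].
cbn [plow pev]. rewrite plus_IZR. apply Rplus_le_compat_l.
destruct (Z.le_gt_cases 0 (plow q)) as [H | H].
- assert (H1 := IZR_le _ _ H). apply Rle_trans with 0; [ | nra ].
  apply IZR_le, Z.le_min_l.
- assert (H1 := IZR_lt _ _ H).
  apply Rle_trans with (IZR (9 * plow q / 10)); [ apply IZR_le, Z.le_min_r | ].
  assert (H2 : (10 * (9 * plow q / 10) <= 9 * plow q)%Z) by (apply Z.mul_div_le; lia).
  apply IZR_le in H2. rewrite !mult_IZR in H2. nra.
Qed.

Lemma pev_nonneg (p : list Z) (x : R) :
  (0 <=? plow p)%Z = true -> 0 <= x <= 9 / 10 -> 0 <= pev p x.
Proof.
intros H Hx. apply Rle_trans with (2 := plow_le p x Hx). apply IZR_le.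
now apply Z.leb_le.
Qed.

Lemma geom_low (N : nat) (x : R) :
  0 <= x < 1 -> pev (0%Z :: repeat 1%Z N) x <= x / (1 - x).
Proof.
intros Hx. assert (H : (1 - x) * pev (repeat 1%Z N) x = 1 - x ^ N).
{ induction N as [ | N IH]; simpl; [ ring | ].
  rewrite Rmult_plus_distr_l.
  replace ((1 - x) * (x * pev (repeat 1%Z N) x))
    with (x * ((1 - x) * pev (repeat 1%Z N) x)) by ring.
  rewrite IH. ring. }
assert (H1 : 0 <= x ^ N) by (apply pow_le; lra).
simpl. apply (Rmult_le_reg_r (1 - x)); [ lra | ].
replace (x / (1 - x) * (1 - x)) with x by (field; lra).
assert (x * ((1 - x) * pev (repeat 1%Z N) x) <= x * 1); [ | lra ].
apply Rmult_le_compat_l; lra.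
Qed.

(** The last coefficient 10 is the maximum of 1 / (1 - x) on [0, 9/10]; it absorbs the whole tail of
    the geometric series. *)
Lemma geom_up (N : nat) (x : R) :
  0 <= x <= 9 / 10 -> x / (1 - x) <= pev (0%Z :: repeat 1%Z N ++ [10%Z]) x.
Proof.
intros Hx.
assert (H : / (1 - x) <= pev (repeat 1%Z N ++ [10%Z]) x).
{ induction N as [ | N IH]; simpl.
  - rewrite Rmult_0_r, Rplus_0_r. rewrite <- (Rinv_inv 10).
    apply Rinv_le_contravar; lra.
  - assert (x * / (1 - x) <= x * pev (repeat 1%Z N ++ [10%Z]) x)
      by (apply Rmult_le_compat_l; lra).
    assert (/ (1 - x) = 1 + x * / (1 - x)) by (field; lra). lra. }
cbn [pev]. rewrite Rplus_0_l. unfold Rdiv. apply Rmult_le_compat_l; lra.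
Qed.

(* The Taylor coefficients of Zx and Wx, multiplied by taylor_den and rounded down or up; the last
   coefficient of the upper polynomials also absorbs the rest of the series for x <= 9/10. *)
Definition taylor_den : Z := 61440.
Definition Zx_low : list Z :=
  [0;20480;12288;8777;6826;5585;4726;4096;3614;3233;2925;2671;2457;2275;2118;1981;
   1861;1755;1660;1575;1498]%Z.
Definition Zx_up : list Z :=
  [0;20480;12288;8778;6827;5586;4727;4096;3615;3234;2926;2672;2458;2276;2119;1982;
   1862;1756;1661;1576;14986]%Z.
Definition Wx_low : list Z :=
  [0;30720;19200;13440;10110;7995;6557;5529;4764;4175;3710;3334;3026;2767;2549;2361;
   2199;2057;1932;1821;1722]%Z.
Definition Wx_up : list Z :=
  [0;30720;19200;13440;10110;7995;6558;5530;4765;4176;3711;3336;3027;2769;2550;2362;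
   2200;2058;1933;1822;17132]%Z.

(** Supplies the constant [M] that [comparison_nonneg] asks for near 0. *)
Lemma pev_linear_bound (p : list Z) :
  exists M, 0 <= M /\ forall x, 0 < x <= 9 / 10 -> Rabs (pev (0%Z :: p) x) <= M * x.
Proof.
assert (H : exists M, 0 <= M /\ forall x, 0 < x <= 9 / 10 -> Rabs (pev p x) <= M).
{ induction p as [ | c q [M [HM IH]]].
  - exists 0. split; [ lra | ]. intros. simpl. rewrite Rabs_R0. lra.
  - exists (Rabs (IZR c) + M). split; [ assert (H := Rabs_pos (IZR c)); lra | ].
    intros x Hx. simpl. apply Rle_trans with (1 := Rabs_triang _ _).
    apply Rplus_le_compat_l. rewrite Rabs_mult, (Rabs_pos_eq x) by lra.
    specialize (IH x Hx). assert (H := Rabs_pos (pev q x)). nra. }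
destruct H as [M [HM H]]. exists M. split; [ exact HM | ].
intros x Hx. cbn [pev]. rewrite Rplus_0_l, Rabs_mult, (Rabs_pos_eq x), Rmult_comm by lra.
apply Rmult_le_compat_r; [ lra | auto ].
Qed.

Lemma Rmult_le_compat_neg_r (r a b : R) : r <= 0 -> b <= a -> a * r <= b * r.
Proof. intros. nra. Qed.

Lemma K_sq_bounded (x : R) : 0 < x <= 9 / 10 -> 0 < K_sq x <= 10.
Proof.
intros Hx. assert (HP := PI_RGT_0). assert (HP4 := PI_4).
split; [ assert (H := K_sq_ge_PI2 x ltac:(lra)); lra | ].
apply Rle_trans with (1 := K_sq_le_bound x ltac:(lra)).
assert (H : 2 / 10 <= sqrt (1 - x)).
{ rewrite <- (sqrt_square (2 / 10)) by lra. apply sqrt_le_1_alt. lra. }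
apply (Rmult_le_reg_r (sqrt (1 - x))); [ lra | ].
replace (PI / 2 / sqrt (1 - x) * sqrt (1 - x)) with (PI / 2) by (field; lra). lra.
Qed.

Lemma Zx_linear_bound (x : R) : 0 < x <= 9 / 10 -> 0 < Zx x <= 10 * x.
Proof.
intros Hx. destruct (Zx_bounds x ltac:(lra)) as [H1 H2]. split; [ exact H1 | ].
apply Rlt_le, Rlt_le_trans with (1 := H2).
apply (Rmult_le_reg_r (1 - x)); [ lra | ].
replace (x / (1 - x) * (1 - x)) with x by (field; lra). nra.
Qed.

Lemma Wx_linear_bound (x : R) : 0 < x <= 9 / 10 -> 0 <= Wx x <= 10 * x.
Proof.
intros Hx. destruct (Wx_bounds x ltac:(lra)) as [H1 H2]. split; [ exact H1 | ].
assert (H3 := K_sq_bounded x Hx). nra.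
Qed.

Notation den := (IZR taylor_den).

Lemma den_pos : 0 < den.
Proof. apply (IZR_lt 0). reflexivity. Qed.

(** For p = [Zx_low] and D = den Z - p, 2 x D' = den x / (1 - x) - den Z - 2 x p'. Where D < 0,
    replacing den Z by p lowers this, and den x / (1 - x) - p - 2 x p' >= 0 is a polynomial
    inequality once the geometric series is truncated. So [comparison_nonneg] applies with C = 0. *)
Lemma Zx_low_le (x : R) : 0 < x <= 9 / 10 -> pev Zx_low x <= den * Zx x.
Proof.
revert x. assert (HD := den_pos).
assert (H : forall x, 0 < x <= 9 / 10 -> 0 <= den * Zx x - pev Zx_low x).
{ destruct (pev_linear_bound (tl Zx_low)) as [M [HM HB]].
  change (0%Z :: tl Zx_low) with Zx_low in HB.
  apply (comparison_nonneg _
    (fun x => den * ((x / (1 - x) - Zx x) / (2 * x)) - pev (pder Zx_low) x) _ 0 M); auto.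
  - lra.
  - intros x Hx.
    apply (is_derive_minus (fun x => den * Zx x) (pev Zx_low)); [ | apply pev_derive ].
    apply is_derive_scal. apply Zx_derive. lra.
  - intros x Hx. specialize (HB x Hx). assert (H := Zx_linear_bound x Hx).
    apply Rabs_le_between in HB. nra.
  - intros x Hx Hneg. rewrite Rmult_0_l.
    assert (Hg := geom_low 20 x ltac:(lra)).
    assert (Hp : 0 <= pev (padd (pscal taylor_den (0%Z :: repeat 1%Z 20))
        (pscal (-1) (padd (pmul [0; 2]%Z (pder Zx_low)) Zx_low))) x).
    { apply pev_nonneg; [ vm_compute; reflexivity | lra ]. }
    rewrite pev_padd, !pev_pscal, pev_padd, pev_pmul in Hp.
    cbn [pev] in Hp. change (pev [] x) with 0 in Hp.
    apply (Rmult_le_reg_l (2 * x)); [ lra | ].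
    replace (2 * x * (den * ((x / (1 - x) - Zx x) / (2 * x)) - pev (pder Zx_low) x))
      with (den * (x / (1 - x)) - den * Zx x - 2 * x * pev (pder Zx_low) x) by (field; lra).
    cbn [pev] in Hg. nra. }
intros x Hx. specialize (H x Hx). lra.
Qed.

Lemma Zx_up_ge (x : R) : 0 < x <= 9 / 10 -> den * Zx x <= pev Zx_up x.
Proof.
revert x. assert (HD := den_pos).
assert (H : forall x, 0 < x <= 9 / 10 -> 0 <= pev Zx_up x - den * Zx x).
{ destruct (pev_linear_bound (tl Zx_up)) as [M [HM HB]].
  change (0%Z :: tl Zx_up) with Zx_up in HB.
  apply (comparison_nonneg _
    (fun x => pev (pder Zx_up) x - den * ((x / (1 - x) - Zx x) / (2 * x))) _ 0 (M + 10 * den)); auto.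
  - lra.
  - lra.
  - intros x Hx.
    apply (is_derive_minus (pev Zx_up) (fun x => den * Zx x)); [ apply pev_derive | ].
    apply is_derive_scal. apply Zx_derive. lra.
  - intros x Hx. specialize (HB x Hx). assert (H := Zx_linear_bound x Hx).
    apply Rabs_le_between in HB. nra.
  - intros x Hx Hneg. rewrite Rmult_0_l.
    assert (Hg := geom_up 19 x ltac:(lra)).
    assert (Hp : 0 <= pev (padd (padd (pmul [0; 2]%Z (pder Zx_up)) Zx_up)
        (pscal (- taylor_den) (0%Z :: repeat 1%Z 19 ++ [10%Z]))) x).
    { apply pev_nonneg; [ vm_compute; reflexivity | lra ]. }
    rewrite pev_padd, !pev_pscal, pev_padd, pev_pmul, opp_IZR in Hp.
    cbn [pev] in Hp. change (pev [] x) with 0 in Hp.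
    apply (Rmult_le_reg_l (2 * x)); [ lra | ].
    replace (2 * x * (pev (pder Zx_up) x - den * ((x / (1 - x) - Zx x) / (2 * x))))
      with (2 * x * pev (pder Zx_up) x + den * Zx x - den * (x / (1 - x))) by (field; lra).
    cbn [pev] in Hg. nra. }
intros x Hx. specialize (H x Hx). lra.
Qed.

(** For p = [Wx_low] and D = den W - p, the polynomial check bounds 2 x den D' below by (den W)^2 -
    p^2 = (den W + p) D. As den W + p <= (10 den + M) x, where D < 0 this is at least (10 den + M) x
    D, whence the value of [C]. The upper bound is proved with the same constant. *)
Lemma Wx_low_le (x : R) : 0 < x <= 9 / 10 -> pev Wx_low x <= den * Wx x.
Proof.
revert x. assert (HD := den_pos).
assert (H : forall x, 0 < x <= 9 / 10 -> 0 <= den * Wx x - pev Wx_low x).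
{ destruct (pev_linear_bound (tl Wx_low)) as [M [HM HB]].
  change (0%Z :: tl Wx_low) with Wx_low in HB.
  apply (comparison_nonneg _
    (fun x => den * ((x / (1 - x) + Wx x ^ 2) / (2 * x)) - pev (pder Wx_low) x) _
    ((10 * den + M) / (2 * den)) M); auto.
  - apply Rlt_le, Rdiv_lt_0_compat; lra.
  - intros x Hx.
    apply (is_derive_minus (fun x => den * Wx x) (pev Wx_low)); [ | apply pev_derive ].
    apply is_derive_scal. apply Wx_derive. lra.
  - intros x Hx. specialize (HB x Hx). assert (H := Wx_linear_bound x Hx).
    apply Rabs_le_between in HB. nra.
  - intros x Hx Hneg. specialize (HB x Hx). apply Rabs_le_between in HB.
    assert (HW := Wx_linear_bound x Hx).
    assert (Hg := geom_low 20 x ltac:(lra)).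
    assert (Hp : 0 <= pev (padd (pscal (taylor_den * taylor_den) (0%Z :: repeat 1%Z 20))
        (padd (pmul Wx_low Wx_low)
           (pscal (- taylor_den) (pmul [0; 2]%Z (pder Wx_low))))) x).
    { apply pev_nonneg; [ vm_compute; reflexivity | lra ]. }
    rewrite !pev_padd, !pev_pscal, !pev_pmul, opp_IZR, mult_IZR in Hp.
    cbn [pev] in Hp, Hg. change (pev [] x) with 0 in Hp.
    apply (Rmult_le_reg_l (2 * x * den)); [ nra | ].
    replace (2 * x * den * (den * ((x / (1 - x) + Wx x ^ 2) / (2 * x)) - pev (pder Wx_low) x))
      with (den * den * (x / (1 - x)) + (den * Wx x) * (den * Wx x)
            - den * (2 * x * pev (pder Wx_low) x)) by (field; lra).
    replace (2 * x * den * ((10 * den + M) / (2 * den) * (den * Wx x - pev Wx_low x)))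
      with ((10 * den * x + M * x) * (den * Wx x - pev Wx_low x)) by (field; lra).
    assert (den * den * (0 + x * pev (repeat 1%Z 20) x) <= den * den * (x / (1 - x)))
      by (apply Rmult_le_compat_l; nra).
    assert ((10 * den * x + M * x) * (den * Wx x - pev Wx_low x)
            <= (den * Wx x + pev Wx_low x) * (den * Wx x - pev Wx_low x)).
    { apply Rmult_le_compat_neg_r; [ lra | nra ]. }
    lra. }
intros x Hx. specialize (H x Hx). lra.
Qed.

Lemma Wx_up_ge (x : R) : 0 < x <= 9 / 10 -> den * Wx x <= pev Wx_up x.
Proof.
revert x. assert (HD := den_pos).
assert (H : forall x, 0 < x <= 9 / 10 -> 0 <= pev Wx_up x - den * Wx x).
{ destruct (pev_linear_bound (tl Wx_up)) as [M [HM HB]].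
  change (0%Z :: tl Wx_up) with Wx_up in HB.
  apply (comparison_nonneg _
    (fun x => pev (pder Wx_up) x - den * ((x / (1 - x) + Wx x ^ 2) / (2 * x))) _
    ((10 * den + M) / (2 * den)) (M + 10 * den)); auto.
  - apply Rlt_le, Rdiv_lt_0_compat; lra.
  - lra.
  - intros x Hx.
    apply (is_derive_minus (pev Wx_up) (fun x => den * Wx x)); [ apply pev_derive | ].
    apply is_derive_scal. apply Wx_derive. lra.
  - intros x Hx. specialize (HB x Hx). assert (H := Wx_linear_bound x Hx).
    apply Rabs_le_between in HB. nra.
  - intros x Hx Hneg. specialize (HB x Hx). apply Rabs_le_between in HB.
    assert (HW := Wx_linear_bound x Hx).
    assert (Hg := geom_up 19 x ltac:(lra)).
    assert (Hp : 0 <= pev (padd (pscal taylor_den (pmul [0; 2]%Z (pder Wx_up)))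
        (padd (pscal (- (1)) (pmul Wx_up Wx_up))
           (pscal (- (taylor_den * taylor_den)) (0%Z :: repeat 1%Z 19 ++ [10%Z])))) x).
    { apply pev_nonneg; [ vm_compute; reflexivity | lra ]. }
    rewrite !pev_padd, !pev_pscal, !pev_pmul, !opp_IZR, mult_IZR in Hp.
    cbn [pev] in Hp, Hg. change (pev [] x) with 0 in Hp.
    apply (Rmult_le_reg_l (2 * x * den)); [ nra | ].
    replace (2 * x * den * (pev (pder Wx_up) x - den * ((x / (1 - x) + Wx x ^ 2) / (2 * x))))
      with (den * (2 * x * pev (pder Wx_up) x) - den * den * (x / (1 - x))
            - (den * Wx x) * (den * Wx x)) by (field; lra).
    replace (2 * x * den * ((10 * den + M) / (2 * den) * (pev Wx_up x - den * Wx x)))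
      with ((10 * den * x + M * x) * (pev Wx_up x - den * Wx x)) by (field; lra).
    assert (den * den * (x / (1 - x)) <= den * den * (0 + x * pev (repeat 1%Z 19 ++ [10%Z]) x))
      by (apply Rmult_le_compat_l; nra).
    assert ((10 * den * x + M * x) * (pev Wx_up x - den * Wx x)
            <= (den * Wx x + pev Wx_up x) * (pev Wx_up x - den * Wx x)).
    { apply Rmult_le_compat_neg_r; [ lra | nra ]. }
    lra. }
intros x Hx. specialize (H x Hx). lra.
Qed.

(** * Key inequality for x <= 9/10 *)

(** A homogeneous form: the entry of index i is the coefficient of x^i y^(n-i), where n + 1 is the
    length. With y = 1 - x it gives the basis of [wronS_tab]; with y = [den] it clears the
    denominators of the Taylor bounds. *)
Fixpoint heval (l : list R) (x y : R) : R :=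
  match l with [] => 0 | a :: l' => a * y ^ length l' + x * heval l' x y end.

Fixpoint hpoly (l : list (list Z)) (p q : list Z) : list Z :=
  match l with [] => [] | a :: l' => padd (pmul a (ppow q (length l'))) (pmul p (hpoly l' p q)) end.

Lemma pev_hpoly (l : list (list Z)) (p q : list Z) (t : R) :
  pev (hpoly l p q) t = heval (map (fun a => pev a t) l) (pev p t) (pev q t).
Proof.
induction l as [ | a l IH]; simpl; [ reflexivity | ].
now rewrite pev_padd, !pev_pmul, pev_ppow, IH, length_map.
Qed.

Lemma heval_map_sub {T : Type} (f g h : T -> R) (l : list T) (x y : R) :
  (forall a, f a = g a - h a) ->
  heval (map f l) x y = heval (map g l) x y - heval (map h l) x y.
Proof.
intros H. induction l as [ | a l IH]; simpl; [ ring | ].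
rewrite !length_map, IH, H. ring.
Qed.

Lemma heval_map_le {T : Type} (f g : T -> R) (l : list T) (x x' y : R) :
  (forall a, 0 <= f a <= g a) -> 0 <= x <= x' -> 0 <= y ->
  0 <= heval (map f l) x y <= heval (map g l) x' y.
Proof.
intros H Hx Hy. induction l as [ | a l [IH1 IH2]]; simpl; [ lra | ].
rewrite !length_map. specialize (H a). assert (Hp := pow_le y (length l) Hy).
split.
- apply Rplus_le_le_0_compat; apply Rmult_le_pos; lra.
- apply Rplus_le_compat; [ apply Rmult_le_compat_r; lra | ].
  apply Rmult_le_compat; lra.
Qed.

Section Triple.

Variable s : Z -> Z.

(** The map [s] selects what is kept of each coefficient: all of it, its positive part or its
    negative part. The last two have nonnegative values, hence evaluations that are monotone in [Z0]
    and [W0]. *)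
Definition tri_eval (tab : list (list (list Z))) (x y Z0 W0 d : R) : R :=
  heval (map (fun row => heval (map (fun b => heval (map (fun c => IZR (s c)) b) x y) row)
                           Z0 d) tab) W0 d.

Definition tri_poly (tab : list (list (list Z))) (p q : list Z) (d : Z) : list Z :=
  hpoly (map (fun row => hpoly (map (fun b => hpoly (map (fun c => [s c]) b) [0; 1]%Z [1; -1]%Z)
                                  row) p [d]) tab) q [d].

Lemma pev_tri_poly tab p q d t :
  pev (tri_poly tab p q d) t = tri_eval tab t (1 - t) (pev p t) (pev q t) (IZR d).
Proof.
assert (Hd : pev [d] t = IZR d) by (simpl; ring).
unfold tri_poly, tri_eval. rewrite pev_hpoly, Hd, map_map. f_equal.
apply map_ext; intros row. rewrite pev_hpoly, Hd, map_map. f_equal.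
apply map_ext; intros b. rewrite pev_hpoly, map_map. f_equal; [ | simpl; ring | simpl; ring ].
apply map_ext; intros c. simpl. ring.
Qed.

End Triple.

Lemma tri_eval_sub tab x y Z0 W0 d :
  tri_eval (fun c => c) tab x y Z0 W0 d =
  tri_eval (Z.max 0) tab x y Z0 W0 d - tri_eval (fun c => Z.max 0 (- c)) tab x y Z0 W0 d.
Proof.
unfold tri_eval. apply heval_map_sub; intros row. apply heval_map_sub; intros b.
apply heval_map_sub; intros c. rewrite <- minus_IZR. f_equal. lia.
Qed.

Lemma tri_eval_le s tab x y Z0 W0 Z1 W1 d :
  (forall c, (0 <= s c)%Z) -> 0 <= x -> 0 <= y -> 0 <= Z0 <= Z1 -> 0 <= W0 <= W1 -> 0 <= d ->
  tri_eval s tab x y Z0 W0 d <= tri_eval s tab x y Z1 W1 d.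
Proof.
intros Hs Hx Hy HZ HW Hd. unfold tri_eval.
apply heval_map_le; auto. intros row.
apply heval_map_le; auto. intros b.
apply (heval_map_le (fun c => IZR (s c)) (fun c => IZR (s c))); auto; [ | lra ].
intros c. specialize (Hs c). apply IZR_le in Hs. lra.
Qed.

(** At u = 1/A and v = E/K, [numS] is 4 x^2 (1 - x)^2 times the second derivative of m - 3 l / 4,
    and [denS] is 4 x (1 - x)^2 times that of x l. *)
Definition numS (x u v : R) : R :=
  - v ^ 2 + 2 * x * v + (1 - x) * (1 - 2 * x)
  + 3 / 4 * (u ^ 2 - (3 * x - 1) * u - 2 * (1 - x) ^ 2).

Definition denS (x u : R) : R := - u ^ 2 + (3 - x) * u - 2 * (1 - x) ^ 2.

(* (1 - x) x d/dx of numS and denS along the solutions of u' = u (y - u) / (2 x y),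
   v' = - (v^2 - 2 y v + y) / (2 x y), where y = 1 - x. *)
Definition dnumS (x u v : R) : R :=
  x * (1 - x) * (2 * v + 4 * x - 3 + 3 / 4 * (- 3 * u + 4 * (1 - x)))
  + 3 / 4 * (2 * u - 3 * x + 1) * (u * (1 - x - u) / 2)
  - (2 * x - 2 * v) * ((v ^ 2 - 2 * (1 - x) * v + (1 - x)) / 2).

Definition ddenS (x u : R) : R :=
  x * (1 - x) * (- u + 4 * (1 - x)) + (- 2 * u + 3 - x) * (u * (1 - x - u) / 2).

(** Equals (1 - x) x^2 denS^2 S' for S = numS / (x denS); the summand (1 - x) denS comes from
    differentiating the factor x. *)
Definition wronS (x u v : R) : R :=
  dnumS x u v * denS x u - numS x u v * ((1 - x) * denS x u + ddenS x u).

(* The coefficients b_(k,j,i) in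
   4 z^4 w^3 wronS x (1/z) (1/w) = sum b_(k,j,i) (w-1)^k (z-1)^j x^i (1-x)^(5-i).
   The basis x^i (1-x)^(5-i) keeps the cancellation between positive and negative terms mild. *)
Definition wronS_tab : list (list (list Z)) :=
  [[[0; 0; 1; 0; 3; 0];
     [0; 64; 130; 90; 44; 4];
     [-9; 124; 239; 140; 62; 4];
     [-18; 64; 120; 46; 24; 0];
     [-12; -8; -8; -16; 0; 0]];
    [[0; -44; -97; -88; -27; -4];
     [4; 36; 30; -46; 0; -4];
     [-11; 184; 265; 28; 22; -8];
     [-26; 140; 184; -18; 4; -8];
     [-20; 0; -8; -40; 0; 0]];
    [[0; -54; -103; -82; -21; 0];
     [2; -6; 12; -16; 20; 8];
     [-19; 110; 239; 86; 56; 8];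
     [-32; 90; 170; 24; 24; 0];
     [-20; -8; -8; -32; 0; 0]];
    [[0; -22; -45; -42; -15; 0];
     [2; -10; -24; -56; -28; 0];
     [-1; 46; 85; -2; -16; 0];
     [-4; 54; 98; 24; 0; 0];
     [-4; 8; 16; 0; 0; 0]]]%Z.

(** The factor den^7 comes from homogenizing degree 4 in Z and degree 3 in W. The identity holds for
    every d in place of [den], which keeps large numerals out of [field]. *)
Lemma wronS_tab_eq (x Z W : R) :
  1 + Z <> 0 -> 1 + W <> 0 ->
  tri_eval (fun c => c) wronS_tab x (1 - x) (den * Z) (den * W) den =
  4 * den ^ 7 * (1 + Z) ^ 4 * (1 + W) ^ 3 * wronS x (/ (1 + Z)) (/ (1 + W)).
Proof.
intros HZ HW. unfold tri_eval, wronS_tab. cbn [map heval length].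
unfold wronS, dnumS, ddenS, numS, denS. generalize den; intros d.
field. now split.
Qed.

(* The positive coefficients are evaluated at the lower Taylor bounds and the negative ones at the upper. *)
Lemma wronS_pos_low (x : R) :
  0 < x <= 9 / 10 -> 0 < wronS x (/ (1 + Zx x)) (/ (1 + Wx x)).
Proof.
intros Hx. assert (HD := den_pos).
assert (HZ := Zx_linear_bound x Hx). assert (HW := Wx_linear_bound x Hx).
assert (HT := wronS_tab_eq x (Zx x) (Wx x) ltac:(lra) ltac:(lra)).
set (P := padd (tri_poly (Z.max 0) wronS_tab Zx_low Wx_low taylor_den)
   (pscal (-1) (tri_poly (fun c => Z.max 0 (- c)) wronS_tab Zx_up Wx_up taylor_den))).
(* The four zeros reflect the fourth-order vanishing of [wronS] at 0. They occur because the lower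
   and upper polynomials agree up to degree 2; coefficients of degree 3 first enter in x^4. *)
assert (HP : exists rest, P = 0%Z :: 0%Z :: 0%Z :: 0%Z :: rest /\ (0 <? plow rest)%Z = true).
{ exists (tl (tl (tl (tl P)))). split; vm_compute; reflexivity. }
destruct HP as [rest [HP Hrest]].
assert (Hpos : 0 < pev P x).
{ rewrite HP. cbn [pev]. apply Z.ltb_lt, IZR_lt in Hrest.
  assert (H := plow_le rest x ltac:(lra)).
  replace (0 + x * (0 + x * (0 + x * (0 + x * pev rest x)))) with (x ^ 4 * pev rest x) by ring.
  apply Rmult_lt_0_compat; [ apply pow_lt; lra | lra ]. }
assert (HZl := Zx_low_le x Hx). assert (HZu := Zx_up_ge x Hx).
assert (HWl := Wx_low_le x Hx). assert (HWu := Wx_up_ge x Hx).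
assert (HZ0 : 0 <= pev Zx_low x).
{ apply pev_nonneg; [ vm_compute; reflexivity | lra ]. }
assert (HW0 : 0 <= pev Wx_low x).
{ apply pev_nonneg; [ vm_compute; reflexivity | lra ]. }
unfold P in Hpos. rewrite pev_padd, pev_pscal, !pev_tri_poly in Hpos.
rewrite tri_eval_sub in HT.
assert (H1 : tri_eval (Z.max 0) wronS_tab x (1 - x) (pev Zx_low x) (pev Wx_low x) den
             <= tri_eval (Z.max 0) wronS_tab x (1 - x) (den * Zx x) (den * Wx x) den).
{ apply tri_eval_le; try lra; try (split; lra). intros c. apply Z.le_max_l. }
assert (H2 : tri_eval (fun c => Z.max 0 (- c)) wronS_tab x (1 - x) (den * Zx x) (den * Wx x) den
             <= tri_eval (fun c => Z.max 0 (- c)) wronS_tab x (1 - x) (pev Zx_up x) (pev Wx_up x) den).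
{ apply tri_eval_le; try lra; try (split; nra). intros c. apply Z.le_max_l. }
apply (Rmult_lt_reg_l (4 * den ^ 7 * (1 + Zx x) ^ 4 * (1 + Wx x) ^ 3)); [ | lra ].
repeat apply Rmult_lt_0_compat; try apply pow_lt; lra.
Qed.

(** * Key inequality near x = 1 *)

(** [wA0] to [wA5] and [wB0] to [wB4] are the coefficients in the expansion of z^5 (z + d)^3 wronS
    in powers of z - 15/8. Each coefficient is split as t wA + d wB, where t wA is its value at d =
    0. There is no other term: for t = d = 0, that is x = 1 and u = v, numS = denS / 4 and dnumS =
    ddenS / 4, so wronS = 0. *)
Definition wA0 (t : R) : R :=
    (435375 / 16384) + (-914625 / 16384) * t + (205875 / 2048) * t ^ 2
    + (-118125 / 2048) * t ^ 3 + (3375 / 512) * t ^ 4.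
Definition wA1 (t : R) : R :=
    (161325 / 2048) + (-290925 / 2048) * t + (269325 / 1024) * t ^ 2 + (-16875 / 128) * t ^ 3
    + (675 / 64) * t ^ 4.
Definition wA2 (t : R) : R :=
    (12015 / 128) + (-18585 / 128) * t + (2205 / 8) * t ^ 2 + (-225 / 2) * t ^ 3
    + (45 / 8) * t ^ 4.
Definition wA3 (t : R) : R :=
    (897 / 16) + (-1193 / 16) * t + (1157 / 8) * t ^ 2 + (-85 / 2) * t ^ 3 + (1) * t ^ 4.
Definition wA4 (t : R) : R :=
    (67 / 4) + (-77 / 4) * t + (38) * t ^ 2 + (-6) * t ^ 3.
Definition wA5 (t : R) : R :=
    (2) + (-2) * t + (4) * t ^ 2.
Definition wB0 (t d : R) : R :=
    (3825 / 2048) + (1575 / 256) * d + (-1575 / 128) * t + (-9345 / 256) * t * d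
    + (-207 / 16) * t * d ^ 2 + (-59625 / 2048) * t ^ 2 + (7485 / 256) * t ^ 2 * d
    + (557 / 32) * t ^ 2 * d ^ 2 + (3825 / 32) * t ^ 3 + (1095 / 32) * t ^ 3 * d
    + (-1 / 2) * t ^ 3 * d ^ 2 + (-20025 / 256) * t ^ 4 + (-1095 / 32) * t ^ 4 * d
    + (-19 / 4) * t ^ 4 * d ^ 2 + (675 / 64) * t ^ 5 + (45 / 8) * t ^ 5 * d
    + (1) * t ^ 5 * d ^ 2.
Definition wB1 (t d : R) : R :=
    (915 / 64) + (435 / 32) * d + (-645 / 32) * t + (-1913 / 32) * t * d + (-14) * t * d ^ 2
    + (-4875 / 128) * t ^ 2 + (2059 / 32) * t ^ 2 * d + (20) * t ^ 2 * d ^ 2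
    + (32745 / 128) * t ^ 3 + (1087 / 16) * t ^ 3 * d + (11 / 2) * t ^ 3 * d ^ 2
    + (-4695 / 32) * t ^ 4 + (-52) * t ^ 4 * d + (-6) * t ^ 4 * d ^ 2 + (45 / 4) * t ^ 5
    + (3) * t ^ 5 * d.
Definition wB2 (t d : R) : R :=
    (331 / 16) + (37 / 4) * d + (-11) * t + (-131 / 4) * t * d + (-4) * t * d ^ 2
    + (-35 / 4) * t ^ 2 + (179 / 4) * t ^ 2 * d + (6) * t ^ 2 * d ^ 2 + (3409 / 16) * t ^ 3
    + (49) * t ^ 3 * d + (4) * t ^ 3 * d ^ 2 + (-359 / 4) * t ^ 4 + (-18) * t ^ 4 * d
    + (3) * t ^ 5.
Definition wB3 (t d : R) : R :=
    (11) + (2) * d + (-2) * t + (-6) * t * d + (11 / 2) * t ^ 2 + (10) * t ^ 2 * d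
    + (163 / 2) * t ^ 3 + (12) * t ^ 3 * d + (-18) * t ^ 4.
Definition wB4 (t d : R) : R :=
    (2) + (2) * t ^ 2 + (12) * t ^ 3.

(* Here 1 - x is written t / z: the product t = (1 - x) z stays small while z is unbounded, and 15/8 is a
   lower bound of z at x = 9/10. *)
Lemma wronS_near_1 (t z d : R) :
  0 < z -> 0 <= d ->
  z ^ 5 * (z + d) ^ 3 * wronS (1 - t / z) (/ z) (/ (z + d)) =
  let e := z - 15 / 8 in
  t * wA0 t + d * wB0 t d + e * (t * wA1 t + d * wB1 t d)
  + e ^ 2 * (t * wA2 t + d * wB2 t d) + e ^ 3 * (t * wA3 t + d * wB3 t d)
  + e ^ 4 * (t * wA4 t + d * wB4 t d) + e ^ 5 * (t * wA5 t).
Proof.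
intros Hz Hd. unfold wA0, wA1, wA2, wA3, wA4, wA5, wB0, wB1, wB2, wB3, wB4.
unfold wronS, dnumS, ddenS, numS, denS. cbv zeta. field. lra.
Qed.

Lemma wronS_pos_near_1 (t z d : R) :
  0 < t <= 193 / 1000 -> 15 / 8 <= z -> 0 < d <= 4 / 5 ->
  0 < wronS (1 - t / z) (/ z) (/ (z + d)).
Proof.
intros Ht Hz Hd.
(* These facts bound each monomial in t and d by one of lower degree, so that [lra] can treat
   monomials as atoms. *)
assert (Hst : forall a, 0 <= a -> 0 <= a * t <= 193 / 1000 * a) by (intros; split; nra).
assert (Hsd : forall a, 0 <= a -> 0 <= a * d <= 4 / 5 * a) by (intros; split; nra).
assert (Ht2 := Hst t ltac:(lra)). assert (Ht3 := Hst (t * t) ltac:(lra)).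
assert (Ht4 := Hst (t * t * t) ltac:(lra)). assert (Ht5 := Hst (t * t * t * t) ltac:(lra)).
assert (H1 := Hsd t ltac:(lra)). assert (H1' := Hsd (t * d) ltac:(lra)).
assert (Hd1 := Hst d ltac:(lra)).
assert (H2 := Hsd (t * t) ltac:(lra)). assert (H2' := Hsd (t * t * d) ltac:(lra)).
assert (H3 := Hsd (t * t * t) ltac:(lra)). assert (H3' := Hsd (t * t * t * d) ltac:(lra)).
assert (H4 := Hsd (t * t * t * t) ltac:(lra)).
assert (H4' := Hsd (t * t * t * t * d) ltac:(lra)).
assert (H5 := Hsd (t * t * t * t * t) ltac:(lra)).
assert (H5' := Hsd (t * t * t * t * t * d) ltac:(lra)).
assert (Htd : 0 <= (193 / 1000 - t) * (4 / 5 - d)) by (apply Rmult_le_pos; lra).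
assert (Htt : 0 <= (193 / 1000 - t) * (193 / 1000 - t)) by (apply Rmult_le_pos; lra).
assert (Httd : 0 <= t * ((193 / 1000 - t) * (4 / 5 - d))) by (apply Rmult_le_pos; lra).
(* B may be slightly negative: t A + d B >= a t (1 - d), and d < 1. The constants 19, 50, 50, 30 and
   10 below are lower bounds of [wA0] to [wA4] for t <= 193/1000. *)
assert (Hpos : forall A B a, 0 < a -> a <= A -> 0 <= B + a * t -> 0 < t * A + d * B).
{ intros A B a Ha HA HB. assert (0 < t * a) by (apply Rmult_lt_0_compat; lra).
  assert (0 <= d * (B + a * t)) by (apply Rmult_le_pos; lra).
  assert (t * a <= t * A) by (apply Rmult_le_compat_l; lra). nra. }
assert (P0 : 0 < t * wA0 t + d * wB0 t d)
  by (apply Hpos with 19; unfold wA0, wB0; lra).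
assert (P1 : 0 < t * wA1 t + d * wB1 t d)
  by (apply Hpos with 50; unfold wA1, wB1; lra).
assert (P2 : 0 < t * wA2 t + d * wB2 t d)
  by (apply Hpos with 50; unfold wA2, wB2; lra).
assert (P3 : 0 < t * wA3 t + d * wB3 t d)
  by (apply Hpos with 30; unfold wA3, wB3; lra).
assert (P4 : 0 < t * wA4 t + d * wB4 t d)
  by (apply Hpos with 10; unfold wA4, wB4; lra).
assert (P5 : 0 < t * wA5 t)
  by (apply Rmult_lt_0_compat; unfold wA5; lra).
assert (Hw := wronS_near_1 t z d ltac:(lra) ltac:(lra)). cbv zeta in Hw.
set (e := z - 15 / 8) in *. assert (He : 0 <= e) by (unfold e; lra).
assert (Hp : 0 < z ^ 5 * (z + d) ^ 3 * wronS (1 - t / z) (/ z) (/ (z + d))).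
{ rewrite Hw.
  assert (0 <= e * (t * wA1 t + d * wB1 t d)) by (apply Rmult_le_pos; lra).
  assert (0 <= e ^ 2 * (t * wA2 t + d * wB2 t d)) by (apply Rmult_le_pos; [ now apply pow_le | lra ]).
  assert (0 <= e ^ 3 * (t * wA3 t + d * wB3 t d)) by (apply Rmult_le_pos; [ now apply pow_le | lra ]).
  assert (0 <= e ^ 4 * (t * wA4 t + d * wB4 t d)) by (apply Rmult_le_pos; [ now apply pow_le | lra ]).
  assert (0 <= e ^ 5 * (t * wA5 t)) by (apply Rmult_le_pos; [ now apply pow_le | lra ]).
  lra. }
apply (Rmult_lt_reg_l (z ^ 5 * (z + d) ^ 3)); [ | lra ].
apply Rmult_lt_0_compat; apply pow_lt; lra.
Qed.

(** The singular terms x / (1 - x) cancel: (W - Z)' = (W^2 + Z) / (2 x). *)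
Lemma Wx_gt_Zx (x : R) : 0 < x < 1 -> Zx x < Wx x.
Proof.
intros Hx. apply Rminus_lt_0. revert x Hx.
apply (deriv_pos_pos (fun x => Wx x - Zx x)
  (fun x => (x / (1 - x) + Wx x ^ 2) / (2 * x) - (x / (1 - x) - Zx x) / (2 * x))).
- apply filterlim_locally. intros eps.
  assert (Heps := cond_pos eps). assert (He : 0 < Rmin (9 / 10) (eps / 20)).
  { apply Rmin_glb_lt; lra. }
  exists (mkposreal _ He). intros t Ht Ht0. simpl in Ht.
  change (Rabs (t - 0) < Rmin (9 / 10) (eps / 20)) in Ht.
  assert (Hm1 := Rmin_l (9 / 10) (eps / 20)). assert (Hm2 := Rmin_r (9 / 10) (eps / 20)).
  apply Rabs_def2 in Ht.
  assert (HZ := Zx_linear_bound t ltac:(lra)). assert (HW := Wx_linear_bound t ltac:(lra)).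
  change (Rabs (Wx t - Zx t - 0) < eps). apply Rabs_def1; lra.
- intros t Ht. apply (is_derive_minus Wx Zx); [ now apply Wx_derive | now apply Zx_derive ].
- intros t Ht. assert (HZ := Zx_bounds t Ht).
  replace ((t / (1 - t) + Wx t ^ 2) / (2 * t) - (t / (1 - t) - Zx t) / (2 * t))
    with ((Wx t ^ 2 + Zx t) / (2 * t)) by (field; lra).
  apply Rdiv_lt_0_compat; nra.
Qed.

(** E >= 1 gives K/E <= K, and K - A is bounded by [K_sq_A_sq_bounds]. *)
Lemma Wx_le_Zx_add (x : R) : 0 < x < 1 -> Wx x <= Zx x + ln 2 / sqrt x.
Proof.
intros Hx. assert (HE := E_sq_ge_1 x Hx). destruct (K_sq_A_sq_bounds x Hx) as [_ HK].
assert (Hp : 0 < K_sq x) by (destruct (K_sq_le_E_sq_add x Hx); lra).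
unfold Wx, Zx. assert (K_sq x / E_sq x <= K_sq x); [ | lra ].
apply (Rmult_le_reg_r (E_sq x)); [ lra | ].
replace (K_sq x / E_sq x * E_sq x) with (K_sq x) by (field; lra). nra.
Qed.

(** exp (3/4) >= (1 + 3/40)^10 > 2; applied directly at 3/4, the inequality exp y >= 1 + y would
    only give 7/4. *)
Lemma ln_2_le : ln 2 <= 3 / 4.
Proof.
rewrite <- (ln_exp (3 / 4)). apply ln_le; [ lra | ].
replace (3 / 4) with (3 / 40 + 3 / 40 + 3 / 40 + 3 / 40 + 3 / 40 + 3 / 40 + 3 / 40 + 3 / 40
                      + 3 / 40 + 3 / 40) by field.
rewrite !exp_plus. assert (H := exp_ineq1_le (3 / 40)). set (a := exp (3 / 40)) in *.
replace (a * a * a * a * a * a * a * a * a * a) with (a ^ 10) by ring.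
apply Rle_trans with ((1 + 3 / 40) ^ 10); [ lra | ].
apply pow_incr. lra.
Qed.

Lemma Zx_incr (x y : R) : 0 < x -> x < y -> y < 1 -> Zx x < Zx y.
Proof.
intros Hx Hxy Hy. apply (deriv_pos_incr Zx _ 0 1 x y (fun t Ht => Zx_derive t Ht)); auto.
intros t Ht. assert (H := Zx_bounds t Ht). apply Rdiv_lt_0_compat; lra.
Qed.

Lemma compl_A_sq_decr (x y : R) :
  0 < x -> x < y -> y < 1 -> (1 - y) * (1 + Zx y) < (1 - x) * (1 + Zx x).
Proof.
intros Hx Hxy Hy. apply Ropp_lt_cancel.
apply (deriv_pos_incr (fun t => - ((1 - t) * (1 + Zx t)))
  (fun t => - (- 1 * (1 + Zx t) + (1 - t) * ((t / (1 - t) - Zx t) / (2 * t)))) 0 1); auto.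
- intros t Ht. apply (is_derive_opp (fun t => (1 - t) * (1 + Zx t))).
  apply (is_derive_mult (fun t => 1 - t) (fun t => 1 + Zx t)).
  + auto_derive; [ exact I | ring ].
  + replace ((t / (1 - t) - Zx t) / (2 * t)) with (plus 0 ((t / (1 - t) - Zx t) / (2 * t)))
      by (unfold plus; simpl; ring).
    apply (is_derive_plus (fun _ => 1) Zx); [ | now apply Zx_derive ].
    apply (is_derive_const (K := R_AbsRing) (V := R_NormedModule)).
  + intros; apply Rmult_comm.
- intros t Ht. assert (H := Zx_bounds t Ht).
  replace (- (-1 * (1 + Zx t) + (1 - t) * ((t / (1 - t) - Zx t) / (2 * t))))
    with (1 / 2 + Zx t + (1 - t) * Zx t / (2 * t)) by (field; lra).
  assert (0 < (1 - t) * Zx t / (2 * t)); [ | lra ].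
  apply Rdiv_lt_0_compat; [ apply Rmult_lt_0_compat; lra | lra ].
Qed.

Lemma wronS_pos (x : R) :
  0 < x < 1 -> 0 < wronS x (/ (1 + Zx x)) (/ (1 + Wx x)).
Proof.
intros Hx. destruct (Rle_or_lt x (9 / 10)) as [H9 | H9]; [ apply wronS_pos_low; lra | ].
assert (HZ := Zx_bounds x Hx).
set (z := 1 + Zx x). set (d := Wx x - Zx x).
replace (1 + Wx x) with (z + d) by (unfold z, d; ring).
replace x with (1 - (1 - x) * z / z) at 1 by (field; unfold z; lra).
(* The Taylor bounds at 9/10 yield A >= 15/8 and A / 10 <= 193/1000. Since A increases and (1 - x) A
   decreases, both persist up to 1. *)
assert (H1 := Zx_low_le (9 / 10) ltac:(lra)). assert (H2 := Zx_up_ge (9 / 10) ltac:(lra)).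
unfold taylor_den in H1, H2. cbn [pev Zx_low] in H1. cbn [pev Zx_up] in H2.
apply wronS_pos_near_1.
- split; [ apply Rmult_lt_0_compat; unfold z; lra | ].
  assert (H := compl_A_sq_decr (9 / 10) x ltac:(lra) H9 ltac:(lra)). unfold z. lra.
- assert (H := Zx_incr (9 / 10) x ltac:(lra) H9 ltac:(lra)). unfold z. lra.
- assert (H3 := Wx_gt_Zx x Hx). assert (H4 := Wx_le_Zx_add x Hx).
  (* With ln 2 <= 3/4, the value 15/16 gives exactly the bound 4/5 on d. *)
  assert (H5 : 15 / 16 <= sqrt x).
  { rewrite <- (sqrt_square (15 / 16)) by lra. apply sqrt_le_1_alt. lra. }
  assert (H6 : ln 2 / sqrt x <= 4 / 5).
  { assert (H := ln_2_le). apply (Rmult_le_reg_r (sqrt x)); [ lra | ].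
    replace (ln 2 / sqrt x * sqrt x) with (ln 2) by (field; lra). lra. }
  unfold d. lra.
Qed.

(** * Logarithmic derivatives *)

Definition u_inv (x : R) : R := / (1 + Zx x).
Definition v_inv (x : R) : R := / (1 + Wx x).
(* The quotient of derivatives in the second use of l'Hopital's rule, cleared of denominators. *)
Definition S_ratio (x : R) : R := numS x (u_inv x) (v_inv x) / (x * denS x (u_inv x)).
(* x d/dx of logA and of logK. *)
Definition dlogA (x : R) : R := (u_inv x / (1 - x) - 1) / 2.
Definition dlogK (x : R) : R := (v_inv x / (1 - x) - 1) / 2.
Definition logA (x : R) : R := ln (A_sq x).
Definition logK (x : R) : R := ln (2 * K_sq x / PI).

Lemma A_sq_Zx (x : R) : A_sq x = 1 + Zx x.
Proof. unfold Zx. ring. Qed.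

Lemma u_inv_bounds (x : R) : 0 < x < 1 -> 1 - x < u_inv x < 1.
Proof.
intros Hx. assert (H := Zx_bounds x Hx). unfold u_inv. split.
- rewrite <- (Rinv_inv (1 - x)). apply Rinv_lt_contravar.
  + apply Rmult_lt_0_compat; [ lra | apply Rinv_0_lt_compat; lra ].
  + replace (/ (1 - x)) with (1 + x / (1 - x)) by (field; lra). lra.
- rewrite <- Rinv_1. apply Rinv_lt_contravar; lra.
Qed.

Lemma is_derive_1_plus (f : R -> R) (x d : R) :
  is_derive f x d -> is_derive (fun t => 1 + f t) x d.
Proof.
intros H. replace d with (plus 0 d) by (unfold plus; simpl; ring).
apply (is_derive_plus (fun _ => 1) f); [ | exact H ].
apply (is_derive_const (K := R_AbsRing) (V := R_NormedModule)).
Qed.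

Lemma u_inv_derive (x : R) :
  0 < x < 1 -> is_derive u_inv x (u_inv x * (1 - x - u_inv x) / (2 * x * (1 - x))).
Proof.
intros Hx. assert (H := Zx_bounds x Hx).
replace (u_inv x * (1 - x - u_inv x) / (2 * x * (1 - x)))
  with (- ((x / (1 - x) - Zx x) / (2 * x)) / (1 + Zx x) ^ 2) by (unfold u_inv; field; lra).
apply (is_derive_inv (fun t => 1 + Zx t)); [ | lra ].
apply is_derive_1_plus. now apply Zx_derive.
Qed.

Lemma v_inv_derive (x : R) :
  0 < x < 1 ->
  is_derive v_inv x (- (v_inv x ^ 2 - 2 * (1 - x) * v_inv x + (1 - x)) / (2 * x * (1 - x))).
Proof.
intros Hx. assert (H := Zx_bounds x Hx). assert (H' := Wx_gt_Zx x Hx).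
replace (- (v_inv x ^ 2 - 2 * (1 - x) * v_inv x + (1 - x)) / (2 * x * (1 - x)))
  with (- ((x / (1 - x) + Wx x ^ 2) / (2 * x)) / (1 + Wx x) ^ 2) by (unfold v_inv; field; lra).
apply (is_derive_inv (fun t => 1 + Wx t)); [ | lra ].
apply is_derive_1_plus. now apply Wx_derive.
Qed.

(** Since 1 - x < u < 1, both terms of u (1 + x - u) + 2 (1 - x) (u - (1 - x)) are positive. *)
Lemma denS_pos (x : R) : 0 < x < 1 -> 0 < denS x (u_inv x).
Proof.
intros Hx. assert (H := u_inv_bounds x Hx).
replace (denS x (u_inv x)) with (u_inv x * (1 + x - u_inv x) + 2 * (1 - x) * (u_inv x - (1 - x)))
  by (unfold denS; ring).
assert (0 < u_inv x * (1 + x - u_inv x)) by (apply Rmult_lt_0_compat; lra).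
assert (0 < 2 * (1 - x) * (u_inv x - (1 - x))) by (apply Rmult_lt_0_compat; lra). lra.
Qed.

Lemma numS_derive (x : R) :
  0 < x < 1 ->
  is_derive (fun t => numS t (u_inv t) (v_inv t)) x (dnumS x (u_inv x) (v_inv x) / (x * (1 - x))).
Proof.
intros Hx. assert (Hu := u_inv_derive x Hx). assert (Hv := v_inv_derive x Hx).
unfold numS, dnumS. auto_derive.
- repeat split; eexists; eauto.
- replace (Derive (fun x0 : R => u_inv x0) x) with (u_inv x * (1 - x - u_inv x) / (2 * x * (1 - x)))
    by (symmetry; now apply is_derive_unique).
  replace (Derive (fun x0 : R => v_inv x0) x)
    with (- (v_inv x ^ 2 - 2 * (1 - x) * v_inv x + (1 - x)) / (2 * x * (1 - x)))
    by (symmetry; now apply is_derive_unique).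
  field. lra.
Qed.

Lemma denS_derive (x : R) :
  0 < x < 1 ->
  is_derive (fun t => denS t (u_inv t)) x (ddenS x (u_inv x) / (x * (1 - x))).
Proof.
intros Hx. assert (Hu := u_inv_derive x Hx).
unfold denS, ddenS. auto_derive.
- repeat split; eexists; eauto.
- replace (Derive (fun x0 : R => u_inv x0) x) with (u_inv x * (1 - x - u_inv x) / (2 * x * (1 - x)))
    by (symmetry; now apply is_derive_unique).
  field. lra.
Qed.

Lemma S_ratio_incr : strictly_increasing_01 S_ratio.
Proof.
intros x y Hx Hxy Hy.
apply (deriv_pos_incr S_ratio
  (fun t => wronS t (u_inv t) (v_inv t) / ((1 - t) * t ^ 2 * denS t (u_inv t) ^ 2)) 0 1); auto.
- intros t Ht. assert (HD := denS_pos t Ht).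
  replace (wronS t (u_inv t) (v_inv t) / ((1 - t) * t ^ 2 * denS t (u_inv t) ^ 2))
    with ((dnumS t (u_inv t) (v_inv t) / (t * (1 - t)) * (t * denS t (u_inv t))
           - numS t (u_inv t) (v_inv t) * (1 * denS t (u_inv t) + t * (ddenS t (u_inv t) / (t * (1 - t)))))
          / (t * denS t (u_inv t)) ^ 2) by (unfold wronS; field; lra).
  apply (is_derive_div (fun t => numS t (u_inv t) (v_inv t)) (fun t => t * denS t (u_inv t))).
  + now apply numS_derive.
  + apply (is_derive_mult (fun t => t) (fun t => denS t (u_inv t))).
    * apply (is_derive_id (K := R_AbsRing)).
    * now apply denS_derive.
    * intros; apply Rmult_comm.
  + apply Rmult_integral_contrapositive_currified; lra.
- intros t Ht. assert (HD := denS_pos t Ht). apply Rdiv_lt_0_compat.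
  + now apply wronS_pos.
  + repeat apply Rmult_lt_0_compat; try lra; apply pow_lt; lra.
Qed.

Lemma logA_derive (x : R) : 0 < x < 1 -> is_derive logA x (dlogA x / x).
Proof.
intros Hx. assert (H := Zx_bounds x Hx). assert (HA := A_sq_Zx x).
replace (dlogA x / x) with ((/ (1 - x) - A_sq x) / (2 * x) * / A_sq x).
- apply (is_derive_comp ln A_sq); [ apply is_derive_ln; lra | now apply A_sq_derive ].
- unfold dlogA, u_inv. rewrite HA. field. lra.
Qed.

Lemma logK_derive (x : R) : 0 < x < 1 -> is_derive logK x (dlogK x / x).
Proof.
intros Hx. assert (HE := E_sq_ge_1 x Hx). destruct (K_sq_le_E_sq_add x Hx) as [HK _].
assert (HP := PI_RGT_0).
replace (dlogK x / x) with
  ((2 / PI) * ((E_sq x - (1 - x) * K_sq x) / (2 * x * (1 - x))) * / (2 / PI * K_sq x)).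
- apply is_derive_ext with (fun t => ln (2 / PI * K_sq t)).
  { intros t. unfold logK. f_equal. field. lra. }
  apply (is_derive_comp ln (fun t => 2 / PI * K_sq t)).
  + apply is_derive_ln. apply Rmult_lt_0_compat; [ apply Rdiv_lt_0_compat; lra | lra ].
  + apply is_derive_scal. now apply K_sq_derive.
- unfold dlogK, v_inv, Wx. field. lra.
Qed.

Lemma dlogA_derive (x : R) :
  0 < x < 1 -> is_derive dlogA x (u_inv x * (1 + x - u_inv x) / (4 * x * (1 - x) ^ 2)).
Proof.
intros Hx. assert (Hu := u_inv_derive x Hx). unfold dlogA. auto_derive.
- repeat split; [ eexists; eauto | lra ].
- replace (Derive (fun x0 : R => u_inv x0) x) with (u_inv x * (1 - x - u_inv x) / (2 * x * (1 - x)))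
    by (symmetry; now apply is_derive_unique).
  field. lra.
Qed.

Lemma dlogK_derive (x : R) :
  0 < x < 1 -> is_derive dlogK x ((- v_inv x ^ 2 + 2 * v_inv x - (1 - x)) / (4 * x * (1 - x) ^ 2)).
Proof.
intros Hx. assert (Hv := v_inv_derive x Hx). unfold dlogK. auto_derive.
- repeat split; [ eexists; eauto | lra ].
- replace (Derive (fun x0 : R => v_inv x0) x)
    with (- (v_inv x ^ 2 - 2 * (1 - x) * v_inv x + (1 - x)) / (2 * x * (1 - x)))
    by (symmetry; now apply is_derive_unique).
  field. lra.
Qed.

(** * Limits at 0 *)

Section Limits.

Context {F : (R -> Prop) -> Prop} {FF : Filter F}.

Lemma lim_plus (f g : R -> R) (a b : R) :
  filterlim f F (locally a) -> filterlim g F (locally b) ->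
  filterlim (fun x => f x + g x) F (locally (a + b)).
Proof.
intros Hf Hg. apply (filterlim_comp_2 (G := locally a) (H := locally b)) with (1 := Hf) (2 := Hg).
apply (filterlim_plus (K := R_AbsRing) (V := R_NormedModule)).
Qed.

Lemma lim_opp (f : R -> R) (a : R) :
  filterlim f F (locally a) -> filterlim (fun x => - f x) F (locally (- a)).
Proof.
intros Hf. apply filterlim_comp with (1 := Hf).
apply (filterlim_opp (K := R_AbsRing) (V := R_NormedModule)).
Qed.

Lemma lim_minus (f g : R -> R) (a b : R) :
  filterlim f F (locally a) -> filterlim g F (locally b) ->
  filterlim (fun x => f x - g x) F (locally (a - b)).
Proof. intros Hf Hg. apply lim_plus; [ exact Hf | now apply lim_opp ]. Qed.

Lemma lim_mult (f g : R -> R) (a b : R) :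
  filterlim f F (locally a) -> filterlim g F (locally b) ->
  filterlim (fun x => f x * g x) F (locally (a * b)).
Proof.
intros Hf Hg. apply (filterlim_comp_2 (G := locally a) (H := locally b)) with (1 := Hf) (2 := Hg).
apply (filterlim_mult (K := R_AbsRing)).
Qed.

Lemma lim_const (a : R) : filterlim (fun _ => a) F (locally a).
Proof. apply filterlim_const. Qed.

Lemma lim_pow (f : R -> R) (a : R) (n : nat) :
  filterlim f F (locally a) -> filterlim (fun x => f x ^ n) F (locally (a ^ n)).
Proof.
intros Hf. induction n as [ | n IH]; simpl; [ apply lim_const | now apply lim_mult ].
Qed.

Lemma lim_inv (f : R -> R) (a : R) :
  a <> 0 -> filterlim f F (locally a) -> filterlim (fun x => / f x) F (locally (/ a)).
Proof.
intros Ha Hf. apply filterlim_comp with (1 := Hf).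
apply (filterlim_Rbar_inv (Finite a)). intros H. injection H as H. now apply Ha.
Qed.

Lemma lim_comp_derivable (h f : R -> R) (a : R) :
  ex_derive h a -> filterlim f F (locally a) -> filterlim (fun x => h (f x)) F (locally (h a)).
Proof.
intros Hh Hf. apply filterlim_comp with (1 := Hf). now apply (ex_derive_continuous h).
Qed.

Lemma lim_squeeze (f g h : R -> R) (l : R) :
  F (fun x => f x <= g x <= h x) -> filterlim f F (locally l) -> filterlim h F (locally l) ->
  filterlim g F (locally l).
Proof.
intros Hb Hf Hh. apply (filterlim_le_le f g h (Finite l)) with (1 := Hb); assumption.
Qed.

End Limits.

Lemma lim_id_at_right_0 : filterlim (fun x => x) (at_right 0) (locally 0).
Proof. apply filter_le_within. Qed.

Lemma lim_id_at_left_1 : filterlim (fun x => x) (at_left 1) (locally 1).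
Proof. apply filter_le_within. Qed.

Lemma lim_eq {F : (R -> Prop) -> Prop} (f : R -> R) (a b : R) :
  a = b -> filterlim f F (locally a) -> filterlim f F (locally b).
Proof. now intros <-. Qed.

(** Follows the syntax of the expression and leaves the limit to unification; [lim_eq] then compares
    the value found with the wanted one, and the nonzero denominators remain as goals. *)
Ltac lim_rational :=
  repeat first
    [ eassumption | apply lim_id_at_right_0 | apply lim_id_at_left_1
    | eapply lim_const
    | eapply lim_pow | eapply lim_minus | eapply lim_plus | eapply lim_mult | eapply lim_inv
    | eapply lim_opp ].

Lemma at_right_0_intro (b : R) (P : R -> Prop) :
  0 < b -> (forall x, 0 < x < b -> P x) -> at_right 0 P.
Proof.
intros Hb H. exists (mkposreal b Hb). intros x Hx Hx0. apply H.
change (Rabs (x - 0) < b) in Hx. apply Rabs_def2 in Hx. lra.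
Qed.

Lemma at_left_1_intro (a : R) (P : R -> Prop) :
  a < 1 -> (forall x, a < x < 1 -> P x) -> at_left 1 P.
Proof.
intros Ha H. exists (mkposreal (1 - a) ltac:(lra)). intros x Hx Hx0. apply H.
change (Rabs (x - 1) < 1 - a) in Hx. apply Rabs_def2 in Hx. lra.
Qed.

Lemma pev_taylor2 (a b c : Z) (q : list Z) :
  exists M, 0 <= M /\ forall x, 0 < x <= 9 / 10 ->
    Rabs (pev (a :: b :: c :: q) x - (IZR a + IZR b * x + IZR c * x ^ 2)) <= M * x ^ 3.
Proof.
destruct (pev_linear_bound q) as [M [HM H]]. exists M. split; [ exact HM | ].
intros x Hx. specialize (H x Hx). cbn [pev] in *. rewrite Rplus_0_l in H.
replace (IZR a + x * (IZR b + x * (IZR c + x * pev q x)) - (IZR a + IZR b * x + IZR c * x ^ 2))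
  with (x ^ 2 * (x * pev q x)) by ring.
assert (Hx2 : 0 <= x ^ 2) by nra.
rewrite Rabs_mult, (Rabs_pos_eq (x ^ 2)) by exact Hx2.
replace (M * x ^ 3) with (x ^ 2 * (M * x)) by ring. now apply Rmult_le_compat_l.
Qed.

Lemma taylor2_lim (f : R -> R) (c1 c2 : Z) (p q : list Z) :
  (forall x, 0 < x <= 9 / 10 -> pev (0%Z :: c1 :: c2 :: p) x <= den * f x) ->
  (forall x, 0 < x <= 9 / 10 -> den * f x <= pev (0%Z :: c1 :: c2 :: q) x) ->
  filterlim (fun x => (f x - IZR c1 / den * x) / x ^ 2) (at_right 0) (locally (IZR c2 / den)).
Proof.
intros Hp Hq. assert (HD := den_pos).
destruct (pev_taylor2 0 c1 c2 p) as [M1 [HM1 H1]].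
destruct (pev_taylor2 0 c1 c2 q) as [M2 [HM2 H2]].
apply lim_squeeze with (f := fun x => IZR c2 / den - M1 / den * x)
                       (h := fun x => IZR c2 / den + M2 / den * x).
- apply (at_right_0_intro (9 / 10)); [ lra | ]. intros x Hx.
  specialize (Hp x ltac:(lra)). specialize (Hq x ltac:(lra)).
  specialize (H1 x ltac:(lra)). specialize (H2 x ltac:(lra)).
  apply Rabs_le_between in H1. apply Rabs_le_between in H2.
  assert (Hx2 : 0 < x ^ 2) by nra.
  assert (Hf : (f x - IZR c1 / den * x) / x ^ 2 * (den * x ^ 2) = den * f x - IZR c1 * x)
    by (field; lra).
  split; apply (Rmult_le_reg_r (den * x ^ 2)); try (now apply Rmult_lt_0_compat); rewrite Hf.
  + replace ((IZR c2 / den - M1 / den * x) * (den * x ^ 2)) with (IZR c2 * x ^ 2 - M1 * x ^ 3)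
      by (field; lra). lra.
  + replace ((IZR c2 / den + M2 / den * x) * (den * x ^ 2)) with (IZR c2 * x ^ 2 + M2 * x ^ 3)
      by (field; lra). lra.
- eapply lim_eq; [ | lim_rational ]. ring.
- eapply lim_eq; [ | lim_rational ]. ring.
Qed.

Lemma Zx_lim2 : filterlim (fun x => (Zx x - x / 3) / x ^ 2) (at_right 0) (locally (1 / 5)).
Proof.
replace (1 / 5) with (12288 / den) by (unfold taylor_den; field).
apply filterlim_ext with (fun x => (Zx x - 20480 / den * x) / x ^ 2).
{ intros x. f_equal. f_equal. unfold taylor_den. field. }
apply (taylor2_lim Zx 20480 12288 (skipn 3 Zx_low) (skipn 3 Zx_up)).
- apply Zx_low_le.
- apply Zx_up_ge.
Qed.

Lemma Wx_lim2 : filterlim (fun x => (Wx x - x / 2) / x ^ 2) (at_right 0) (locally (5 / 16)).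
Proof.
replace (5 / 16) with (19200 / den) by (unfold taylor_den; field).
apply filterlim_ext with (fun x => (Wx x - 30720 / den * x) / x ^ 2).
{ intros x. f_equal. f_equal. unfold taylor_den. field. }
apply (taylor2_lim Wx 30720 19200 (skipn 3 Wx_low) (skipn 3 Wx_up)).
- apply Wx_low_le.
- apply Wx_up_ge.
Qed.

Lemma lim_ext_at_right_0 (f g : R -> R) (l : R) :
  (forall x, 0 < x < 1 -> f x = g x) ->
  filterlim f (at_right 0) (locally l) -> filterlim g (at_right 0) (locally l).
Proof.
intros H. apply filterlim_ext_loc. apply (at_right_0_intro 1); [ lra | exact H ].
Qed.

Lemma lim_ext_at_left_1 (f g : R -> R) (l : R) :
  (forall x, 0 < x < 1 -> f x = g x) ->
  filterlim f (at_left 1) (locally l) -> filterlim g (at_left 1) (locally l).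
Proof.
intros H. apply filterlim_ext_loc. apply (at_left_1_intro 0); [ lra | exact H ].
Qed.

Lemma Zx_lim1 : filterlim (fun x => Zx x / x) (at_right 0) (locally (1 / 3)).
Proof.
assert (H := Zx_lim2).
apply lim_ext_at_right_0 with (fun x => 1 / 3 + x * ((Zx x - x / 3) / x ^ 2)).
- intros x Hx. field. lra.
- eapply lim_eq; [ | lim_rational ]. ring.
Qed.

Lemma Wx_lim1 : filterlim (fun x => Wx x / x) (at_right 0) (locally (1 / 2)).
Proof.
assert (H := Wx_lim2).
apply lim_ext_at_right_0 with (fun x => 1 / 2 + x * ((Wx x - x / 2) / x ^ 2)).
- intros x Hx. field. lra.
- eapply lim_eq; [ | lim_rational ]. ring.
Qed.

Lemma Zx_lim0 : filterlim Zx (at_right 0) (locally 0).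
Proof.
assert (H := Zx_lim1). apply lim_ext_at_right_0 with (fun x => x * (Zx x / x)).
- intros x Hx. field. lra.
- eapply lim_eq; [ | lim_rational ]. ring.
Qed.

Lemma Wx_lim0 : filterlim Wx (at_right 0) (locally 0).
Proof.
assert (H := Wx_lim1). apply lim_ext_at_right_0 with (fun x => x * (Wx x / x)).
- intros x Hx. field. lra.
- eapply lim_eq; [ | lim_rational ]. ring.
Qed.

Lemma dlogA_lim1 : filterlim (fun x => dlogA x / x) (at_right 0) (locally (1 / 3)).
Proof.
assert (H0 := Zx_lim0). assert (H1 := Zx_lim1).
apply lim_ext_at_right_0
  with (fun x => (1 - (1 - x) * (Zx x / x)) / (2 * (1 - x) * (1 + Zx x))).
- intros x Hx. assert (H := Zx_bounds x Hx). unfold dlogA, u_inv. field. lra.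
- eapply lim_eq; [ | lim_rational ]; lra.
Qed.

Lemma dlogK_lim1 : filterlim (fun x => dlogK x / x) (at_right 0) (locally (1 / 4)).
Proof.
assert (H0 := Wx_lim0). assert (H1 := Wx_lim1).
apply lim_ext_at_right_0
  with (fun x => (1 - (1 - x) * (Wx x / x)) / (2 * (1 - x) * (1 + Wx x))).
- intros x Hx. assert (H := Zx_bounds x Hx). assert (H' := Wx_gt_Zx x Hx).
  unfold dlogK, v_inv. field. lra.
- eapply lim_eq; [ | lim_rational ]; lra.
Qed.

Lemma dlogA_lim0 : filterlim dlogA (at_right 0) (locally 0).
Proof.
assert (H := dlogA_lim1). apply lim_ext_at_right_0 with (fun x => x * (dlogA x / x)).
- intros x Hx. field. lra.
- eapply lim_eq; [ | lim_rational ]. ring.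
Qed.

Lemma dlogK_lim0 : filterlim dlogK (at_right 0) (locally 0).
Proof.
assert (H := dlogK_lim1). apply lim_ext_at_right_0 with (fun x => x * (dlogK x / x)).
- intros x Hx. field. lra.
- eapply lim_eq; [ | lim_rational ]. ring.
Qed.

Lemma logA_lim0 : filterlim logA (at_right 0) (locally 0).
Proof.
apply (lim_eq _ (ln 1) 0 ln_1). apply (lim_comp_derivable ln A_sq).
- eexists. apply is_derive_ln. lra.
- assert (H := Zx_lim0). apply filterlim_ext with (fun x => 1 + Zx x).
  { intros x. unfold Zx. ring. }
  eapply lim_eq; [ | lim_rational ]. ring.
Qed.

Lemma K_sq_lim0 : filterlim K_sq (at_right 0) (locally (PI / 2)).
Proof.
apply lim_squeeze with (f := fun _ => PI / 2) (h := fun x => PI / 2 / sqrt (1 - x)).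
- apply (at_right_0_intro 1); [ lra | ]. intros x Hx. split.
  + now apply K_sq_ge_PI2.
  + now apply K_sq_le_bound.
- apply lim_const.
- assert (H : filterlim (fun x => sqrt (1 - x)) (at_right 0) (locally (sqrt 1))).
  { apply (lim_comp_derivable sqrt (fun x => 1 - x)).
    - auto_derive. lra.
    - eapply lim_eq; [ | lim_rational ]. ring. }
  rewrite sqrt_1 in H. eapply lim_eq; [ | lim_rational ]; lra.
Qed.

Lemma logK_lim0 : filterlim logK (at_right 0) (locally 0).
Proof.
assert (HP := PI_RGT_0). apply (lim_eq _ (ln 1) 0 ln_1). apply (lim_comp_derivable ln (fun x => 2 * K_sq x / PI)).
- eexists. apply is_derive_ln. lra.
- assert (H := K_sq_lim0). eapply lim_eq; [ | lim_rational ]; [ field | .. ]; lra.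
Qed.

Lemma S_ratio_lim0 : filterlim S_ratio (at_right 0) (locally (1 / 320)).
Proof.
assert (HZ0 := Zx_lim0). assert (HZ1 := Zx_lim1). assert (HZ2 := Zx_lim2).
assert (HW0 := Wx_lim0). assert (HW1 := Wx_lim1). assert (HW2 := Wx_lim2).
(* Second-order remainders: u = 1 - x/3 + x^2 e and v = 1 - x/2 + x^2 f, with e -> 1/9 - 1/5 and f
   -> 1/4 - 5/16. Then numS / x^2 -> 1/120 and denS / x -> 8/3, whose quotient is 1/320. *)
set (e := fun x => (Zx x / x / 3 - (Zx x - x / 3) / x ^ 2) / (1 + Zx x)).
set (f := fun x => (Wx x / x / 2 - (Wx x - x / 2) / x ^ 2) / (1 + Wx x)).
assert (He : filterlim e (at_right 0) (locally (- 4 / 45))).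
{ unfold e. eapply lim_eq; [ | lim_rational ]; lra. }
assert (Hf : filterlim f (at_right 0) (locally (- 1 / 16))).
{ unfold f. eapply lim_eq; [ | lim_rational ]; lra. }
apply lim_ext_at_right_0 with (fun x =>
  (1 / 12 - 2 * f x + 9 / 4 * e x + x * (3 * f x - 11 / 4 * e x)
     + x ^ 2 * (3 / 4 * e x ^ 2 - f x ^ 2))
  / (8 / 3 + x * (e x - 16 / 9) - x ^ 2 * e x / 3 - x ^ 3 * e x ^ 2)).
- intros x Hx. assert (HZ := Zx_bounds x Hx). assert (HW := Wx_gt_Zx x Hx).
  assert (Hu : u_inv x = 1 - x / 3 + x ^ 2 * e x) by (unfold u_inv, e; field; lra).
  assert (Hv : v_inv x = 1 - x / 2 + x ^ 2 * f x) by (unfold v_inv, f; field; lra).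
  assert (HD := denS_pos x Hx).
  assert (HN : numS x (u_inv x) (v_inv x) = x ^ 2 *
    (1 / 12 - 2 * f x + 9 / 4 * e x + x * (3 * f x - 11 / 4 * e x)
     + x ^ 2 * (3 / 4 * e x ^ 2 - f x ^ 2))).
  { rewrite Hu, Hv. unfold numS. field. }
  assert (HD' : denS x (u_inv x) = x *
    (8 / 3 + x * (e x - 16 / 9) - x ^ 2 * e x / 3 - x ^ 3 * e x ^ 2)).
  { rewrite Hu. unfold denS. field. }
  unfold S_ratio. rewrite HN. rewrite HD' in HD |- *.
  revert HD; generalize (8 / 3 + x * (e x - 16 / 9) - x ^ 2 * e x / 3 - x ^ 3 * e x ^ 2).
  intros Q HQ. assert (Q <> 0) by (intros H; rewrite H in HQ; lra).
  field. split; lra.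
- eapply lim_eq; [ | lim_rational ]; lra.
Qed.

(** * Limits at 1 *)

(** (1 + r) / (1 - r) = (1 + r)^2 / (1 - x) >= 1 / (1 - x), and dividing arth r by r < 1 only
    increases it. *)
Lemma A_sq_ge_ln (x : R) : 0 < x < 1 -> - ln (1 - x) / 2 <= A_sq x.
Proof.
intros Hx. destruct (sqrt_01 x Hx) as [Hs Hs2]. set (r := sqrt x) in *.
assert (H1 : - ln (1 - x) / 2 <= arth r).
{ unfold arth. rewrite <- ln_Rinv by lra.
  apply Rmult_le_compat_r; [ lra | ]. apply ln_le; [ apply Rinv_0_lt_compat; lra | ].
  rewrite <- Hs2. replace ((1 + r) / (1 - r)) with ((1 + r) ^ 2 * / (1 - r * r)) by (field; nra).
  assert (0 < / (1 - r * r)) by (apply Rinv_0_lt_compat; nra).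
  rewrite <- (Rmult_1_l (/ (1 - r * r))) at 1. apply Rmult_le_compat_r; nra. }
assert (H2 : A_sq x * r = arth r) by (unfold A_sq; fold r; field; lra).
assert (H3 := Zx_bounds x Hx). assert (H4 := A_sq_Zx x). nra.
Qed.

Lemma A_sq_large (M : R) : at_left 1 (fun x => M < A_sq x).
Proof.
assert (He := exp_pos (- 2 * M)).
apply (at_left_1_intro (Rmax 0 (1 - exp (- 2 * M)))); [ apply Rmax_lub_lt; lra | ].
intros x Hx. assert (H1 := Rmax_l 0 (1 - exp (- 2 * M))).
assert (H2 := Rmax_r 0 (1 - exp (- 2 * M))).
apply Rlt_le_trans with (2 := A_sq_ge_ln x ltac:(lra)).
assert (ln (1 - x) < ln (exp (- 2 * M))) by (apply ln_increasing; lra).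
rewrite ln_exp in H. lra.
Qed.

Lemma u_inv_lim1 : filterlim u_inv (at_left 1) (locally 0).
Proof.
apply filterlim_locally. intros eps. assert (Heps := cond_pos eps).
assert (H0 : at_left 1 (fun x => 0 < x)) by (apply (at_left_1_intro 0); intros; lra).
apply filter_imp with (2 := filter_and _ _ (A_sq_large (/ eps)) H0).
intros x [H H']. change (Rabs (u_inv x - 0) < eps). unfold u_inv. rewrite <- A_sq_Zx, Rminus_0_r.
assert (0 < / eps) by now apply Rinv_0_lt_compat.
rewrite Rabs_pos_eq by (apply Rlt_le, Rinv_0_lt_compat; lra).
rewrite <- (Rinv_inv eps). apply Rinv_lt_contravar; [ apply Rmult_lt_0_compat | ]; lra.
Qed.

Lemma sqrt_lim1 : filterlim sqrt (at_left 1) (locally 1).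
Proof.
apply (lim_eq _ (sqrt 1) 1 sqrt_1). apply (lim_comp_derivable sqrt (fun x => x)).
- auto_derive. lra.
- apply lim_id_at_left_1.
Qed.

(** From ln q = 2 ln (sqrt q) <= 2 sqrt q. This crude growth bound is enough for (1 - x) A to tend
    to 0 like sqrt (1 - x). *)
Lemma arth_le_sqrt (r : R) : 0 < r < 1 -> arth r <= sqrt ((1 + r) / (1 - r)).
Proof.
intros Hr. unfold arth. assert (Hq : 0 < (1 + r) / (1 - r)) by (apply Rdiv_lt_0_compat; lra).
set (q := (1 + r) / (1 - r)) in *. assert (Hs : 0 < sqrt q) by now apply sqrt_lt_R0.
rewrite <- (sqrt_sqrt q) at 1 by lra. rewrite ln_mult by assumption.
assert (H : ln (sqrt q) <= sqrt q); [ | lra ].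
rewrite <- (ln_exp (sqrt q)) at 2. apply ln_le; [ exact Hs | ].
assert (H := exp_ineq1_le (sqrt q)). lra.
Qed.

Lemma compl_A_sq_lim1 : filterlim (fun x => (1 - x) * A_sq x) (at_left 1) (locally 0).
Proof.
assert (Hs := sqrt_lim1).
assert (Hc : filterlim (fun x => sqrt (1 - x)) (at_left 1) (locally 0)).
{ apply (lim_eq _ (sqrt 0) 0 sqrt_0). apply filterlim_comp with (G := locally 0) (g := sqrt).
  - eapply lim_eq; [ | lim_rational ]. ring.
  - apply (continuity_pt_filterlim sqrt 0). apply continuity_pt_sqrt. lra. }
apply lim_squeeze with (f := fun _ => 0) (h := fun x => 2 * sqrt (1 - x) / sqrt x).
- apply (at_left_1_intro 0); [ lra | ]. intros x Hx.
  assert (HZ := Zx_bounds x Hx). split; [ rewrite A_sq_Zx; apply Rmult_le_pos; lra | ].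
  destruct (sqrt_01 x Hx) as [Hr Hr2].
  assert (Hy : 0 < sqrt (1 - x)) by (apply sqrt_lt_R0; lra).
  assert (H1 := arth_le_sqrt (sqrt x) Hr).
  assert (H2 : (1 - x) * sqrt ((1 + sqrt x) / (1 - sqrt x)) = sqrt (1 - x) * (1 + sqrt x)).
  { replace ((1 + sqrt x) / (1 - sqrt x)) with ((1 + sqrt x) ^ 2 / (1 - x))
      by (rewrite <- Hr2 at 2; field; nra).
    rewrite sqrt_div_alt, sqrt_pow2 by lra.
    rewrite <- (sqrt_sqrt (1 - x)) at 1 by lra. field. lra. }
  unfold A_sq. unfold Rdiv at 1 2. rewrite <- Rmult_assoc.
  apply Rmult_le_compat_r; [ apply Rlt_le, Rinv_0_lt_compat; lra | ].
  apply Rle_trans with ((1 - x) * sqrt ((1 + sqrt x) / (1 - sqrt x))).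
  + apply Rmult_le_compat_l; lra.
  + rewrite H2. nra.
- apply lim_const.
- eapply lim_eq; [ | lim_rational ]; lra.
Qed.

Lemma ln2_div_sqrt_u_inv_lim1 :
  filterlim (fun x => ln 2 / sqrt x * u_inv x) (at_left 1) (locally 0).
Proof.
assert (Hs := sqrt_lim1). assert (Hu := u_inv_lim1).
eapply lim_eq; [ | lim_rational ]; lra.
Qed.

(** v/u = 1 / (1 + (W - Z) u), where W - Z stays bounded near 1 and u tends to 0. *)
Lemma v_inv_u_inv_lim1 : filterlim (fun x => v_inv x / u_inv x) (at_left 1) (locally 1).
Proof.
assert (H : filterlim (fun x => (Wx x - Zx x) * u_inv x) (at_left 1) (locally 0)).
{ apply lim_squeeze with (f := fun _ => 0) (h := fun x => ln 2 / sqrt x * u_inv x).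
  - apply (at_left_1_intro 0); [ lra | ]. intros x Hx.
    assert (H1 := u_inv_bounds x Hx). assert (H2 := Wx_gt_Zx x Hx). assert (H3 := Wx_le_Zx_add x Hx).
    split; [ apply Rmult_le_pos | apply Rmult_le_compat_r ]; lra.
  - apply lim_const.
  - apply ln2_div_sqrt_u_inv_lim1. }
apply lim_ext_at_left_1 with (fun x => / (1 + (Wx x - Zx x) * u_inv x)).
- intros x Hx. assert (H1 := Zx_bounds x Hx). assert (H2 := Wx_gt_Zx x Hx).
  unfold v_inv, u_inv. field. lra.
- apply (lim_eq _ (/ 1) 1 Rinv_1). apply lim_inv; [ lra | ]. eapply lim_eq; [ | lim_rational ]. ring.
Qed.

(** Numerator and denominator both vanish at 1 and are divided by u. As v/u -> 1 and (1 - x)/u = (1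
    - x) A -> 0, they tend to 2 - 3/2 = 1/2 and to 2. *)
Lemma S_ratio_lim1 : filterlim S_ratio (at_left 1) (locally (1 / 4)).
Proof.
assert (Hu := u_inv_lim1). assert (Hvu := v_inv_u_inv_lim1). assert (Hy := compl_A_sq_lim1).
apply lim_ext_at_left_1 with (fun x =>
  (- (v_inv x / u_inv x) ^ 2 * u_inv x + 2 * x * (v_inv x / u_inv x) + (1 - x) * A_sq x * (1 - 2 * x)
   + 3 / 4 * (u_inv x - (3 * x - 1) - 2 * (1 - x) * ((1 - x) * A_sq x)))
  / (x * (- u_inv x + (3 - x) - 2 * (1 - x) * ((1 - x) * A_sq x)))).
- intros x Hx. assert (H1 := u_inv_bounds x Hx). assert (HD := denS_pos x Hx).
  assert (HA : A_sq x = / u_inv x) by (unfold u_inv; rewrite Rinv_inv; apply A_sq_Zx).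
  rewrite HA. unfold S_ratio, numS. unfold denS in HD.
  replace (- u_inv x + (3 - x) - 2 * (1 - x) * ((1 - x) * / u_inv x)) with (denS x (u_inv x) / u_inv x)
    by (unfold denS; field; lra).
  unfold denS. field. repeat split; lra.
- eapply lim_eq; [ | lim_rational ]; [ field | lra ].
Qed.

Lemma S_ratio_bounds (x : R) : 0 < x < 1 -> 1 / 320 < S_ratio x < 1 / 4.
Proof.
intros Hx. split.
- apply Rle_lt_trans with (S_ratio (x / 2)); [ | apply S_ratio_incr; lra ].
  apply (filterlim_le (F := at_right 0) S_ratio (fun _ => S_ratio (x / 2)) (1 / 320) (S_ratio (x / 2))).
  + apply (at_right_0_intro (x / 2)); [ lra | ]. intros t Ht. apply Rlt_le, S_ratio_incr; lra.
  + apply S_ratio_lim0.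
  + apply lim_const.
- apply Rlt_le_trans with (S_ratio ((x + 1) / 2)); [ apply S_ratio_incr; lra | ].
  apply (filterlim_le (F := at_left 1) (fun _ => S_ratio ((x + 1) / 2)) S_ratio (S_ratio ((x + 1) / 2)) (1 / 4)).
  + apply (at_left_1_intro ((x + 1) / 2)); [ lra | ]. intros t Ht. apply Rlt_le, S_ratio_incr; lra.
  + apply lim_const.
  + apply S_ratio_lim1.
Qed.

Lemma logA_large (M : R) : at_left 1 (fun x => M < logA x).
Proof.
assert (H0 : at_left 1 (fun x => 0 < x < 1)) by (apply (at_left_1_intro 0); intros; lra).
apply filter_imp with (2 := A_sq_large (exp M)).
intros x H. rewrite <- (ln_exp M). apply ln_increasing; [ apply exp_pos | exact H ].
Qed.

Lemma logA_inv_lim1 : filterlim (fun x => / logA x) (at_left 1) (locally 0).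
Proof.
apply filterlim_locally. intros eps. assert (Heps := cond_pos eps).
apply filter_imp with (2 := logA_large (/ eps)).
intros x H. change (Rabs (/ logA x - 0) < eps). rewrite Rminus_0_r.
assert (0 < / eps) by now apply Rinv_0_lt_compat.
rewrite Rabs_pos_eq by (apply Rlt_le, Rinv_0_lt_compat; lra).
rewrite <- (Rinv_inv eps). apply Rinv_lt_contravar; [ apply Rmult_lt_0_compat | ]; lra.
Qed.

Lemma logA_pos (x : R) : 0 < x < 1 -> 0 < logA x.
Proof.
intros Hx. assert (H := Zx_bounds x Hx). rewrite <- ln_1. apply ln_increasing; [ lra | ].
rewrite A_sq_Zx. lra.
Qed.

Lemma compl_logA_lim1 : filterlim (fun x => (1 - x) * logA x) (at_left 1) (locally 0).
Proof.
apply lim_squeeze with (f := fun _ => 0) (h := fun x => (1 - x) * A_sq x).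
- apply (at_left_1_intro 0); [ lra | ]. intros x Hx. assert (H := logA_pos x Hx).
  assert (H1 := Zx_bounds x Hx). assert (H2 := A_sq_Zx x).
  split; [ apply Rmult_le_pos; lra | apply Rmult_le_compat_l; [ lra | ] ].
  unfold logA. rewrite <- (ln_exp (A_sq x)) at 2. apply ln_le; [ lra | ].
  assert (H3 := exp_ineq1_le (A_sq x)). lra.
- apply lim_const.
- apply compl_A_sq_lim1.
Qed.

(** The difference is ln (pi/2) - ln (K/A), and K/A -> 1 because K - A is bounded near 1 while A is
    not. *)
Lemma logA_logK_lim1 : filterlim (fun x => logA x - logK x) (at_left 1) (locally (ln (PI / 2))).
Proof.
assert (HP := PI_RGT_0).
assert (H : filterlim (fun x => K_sq x / A_sq x) (at_left 1) (locally 1)).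
{ apply lim_squeeze with (f := fun _ => 1) (h := fun x => 1 + ln 2 / sqrt x * u_inv x).
  - apply (at_left_1_intro 0); [ lra | ]. intros x Hx.
    assert (H1 := Zx_bounds x Hx). assert (H2 := A_sq_Zx x).
    destruct (K_sq_A_sq_bounds x Hx) as [H3 H4]. destruct (sqrt_01 x Hx) as [Hs _].
    split; apply (Rmult_le_reg_r (A_sq x)); try lra.
    + replace (K_sq x / A_sq x * A_sq x) with (K_sq x) by (field; lra). lra.
    + replace (K_sq x / A_sq x * A_sq x) with (K_sq x) by (field; lra).
      unfold u_inv. rewrite <- H2.
      replace ((1 + ln 2 / sqrt x * / A_sq x) * A_sq x) with (A_sq x + ln 2 / sqrt x) by (field; lra).
      exact H4.
  - apply lim_const.
  - assert (H := ln2_div_sqrt_u_inv_lim1). eapply lim_eq; [ | apply lim_plus; [ apply lim_const | exact H ] ]. ring. }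
apply lim_ext_at_left_1 with (fun x => ln (PI / 2) - ln (K_sq x / A_sq x)).
- intros x Hx. assert (H1 := Zx_bounds x Hx). assert (H2 := A_sq_Zx x).
  assert (H3 := K_sq_ge_PI2 x Hx). unfold logA, logK.
  rewrite !ln_div by lra. rewrite ln_mult by lra. ring.
- apply (lim_eq _ (ln (PI / 2) - ln 1)); [ rewrite ln_1; ring | ].
  apply lim_minus; [ apply lim_const | ].
  apply (lim_comp_derivable ln (fun x => K_sq x / A_sq x)); [ | exact H ].
  eexists. apply is_derive_ln. lra.
Qed.

(** * Monotonicity and ranges *)

(** Monotonicity confines the values strictly between the limits; the intermediate value theorem
    reaches them all. [b] is extended for the sake of [g4_sq]. *)
Lemma onto_of_limits (h : R -> R) (a : R) (b : Rbar) :
  strictly_increasing_01 h ->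
  (forall x, 0 < x < 1 -> ex_derive h x) ->
  filterlim h (at_right 0) (locally a) ->
  filterlim h (at_left 1) (Rbar_locally b) ->
  maps_01_onto h a b.
Proof.
intros Hi Hd Ha Hb y. split.
- intros [r [Hr Hy]]. split.
  + simpl. apply Rle_lt_trans with (h (r / 2)); [ | rewrite <- Hy; apply Hi; lra ].
    apply (filterlim_le (F := at_right 0) h (fun _ => h (r / 2)) a (h (r / 2))).
    * apply (at_right_0_intro (r / 2)); [ lra | ]. intros t Ht. apply Rlt_le, Hi; lra.
    * exact Ha.
    * apply lim_const.
  + apply Rbar_lt_le_trans with (h ((r + 1) / 2)); [ simpl; rewrite <- Hy; apply Hi; lra | ].
    apply (filterlim_le (F := at_left 1) (fun _ => h ((r + 1) / 2)) h (h ((r + 1) / 2)) b).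
    * apply (at_left_1_intro ((r + 1) / 2)); [ lra | ]. intros t Ht. apply Rlt_le, Hi; lra.
    * apply lim_const.
    * exact Hb.
- intros [Hya Hyb].
  assert (H1 : at_right 0 (fun t => 0 < t < 1 /\ h t < y)).
  { apply filter_and.
    - apply (at_right_0_intro 1); [ lra | auto ].
    - apply (Ha (fun z => z < y)). now apply (open_lt y). }
  assert (H2 : at_left 1 (fun t => 0 < t < 1 /\ y < h t)).
  { apply filter_and.
    - apply (at_left_1_intro 0); [ lra | auto ].
    - apply (Hb (fun z => y < z)). apply (open_Rbar_gt' b y Hyb). }
  destruct (filter_ex _ H1) as [s [Hs Hsy]]. destruct (filter_ex _ H2) as [t [Ht Hty]].
  assert (Hst : s < t).
  { destruct (Rlt_or_le s t) as [H | H]; [ exact H | exfalso ].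
    destruct (Req_dec s t) as [He | He]; [ rewrite He in Hsy; lra | ].
    assert (h t < h s) by (apply Hi; lra). lra. }
  destruct (Ranalysis5.IVT_interv (fun x => h x - y) s t) as [r [Hr Hr0]]; try lra.
  { intros x Hx. apply continuity_pt_filterlim.
    apply (ex_derive_continuous (fun x => h x - y)).
    apply (ex_derive_minus h (fun _ => y)); [ apply Hd; lra | apply ex_derive_const ]. }
  exists r. split; lra.
Qed.

Lemma onto_comp_sqr (g h : R -> R) (a b : Rbar) :
  (forall r, 0 < r < 1 -> g r = h (r ^ 2)) -> maps_01_onto h a b -> maps_01_onto g a b.
Proof.
intros Hg Hh y. rewrite <- (Hh y). split.
- intros [r [Hr <-]]. exists (r ^ 2). split; [ nra | ]. symmetry. now apply Hg.
- intros [x [Hx <-]]. destruct (sqrt_01 x Hx) as [Hs Hs2]. exists (sqrt x).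
  split; [ exact Hs | ]. rewrite Hg by exact Hs. f_equal. simpl. lra.
Qed.

Lemma incr_comp_sqr (g h : R -> R) :
  (forall r, 0 < r < 1 -> g r = h (r ^ 2)) ->
  strictly_increasing_01 h -> strictly_increasing_01 g.
Proof.
intros Hg Hh x y Hx Hxy Hy. rewrite !Hg by lra. apply Hh; nra.
Qed.

Definition log_gap (x : R) : R := logK x - 3 / 4 * logA x.
Definition f_sq (x : R) : R := log_gap x / (x * logA x).
(** The quotient of the derivatives of [log_gap] and x l. Both derivatives tend to 0 at 0 again, and
    the quotient of their own derivatives is [S_ratio]. *)
Definition lh_ratio (x : R) : R := (dlogK x - 3 / 4 * dlogA x) / x / (logA x + dlogA x).

Lemma dlogA_pos (x : R) : 0 < x < 1 -> 0 < dlogA x.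
Proof.
intros Hx. assert (H := u_inv_bounds x Hx). unfold dlogA.
assert (1 < u_inv x / (1 - x)); [ | lra ].
apply (Rmult_lt_reg_r (1 - x)); [ lra | ].
replace (u_inv x / (1 - x) * (1 - x)) with (u_inv x) by (field; lra). lra.
Qed.

Lemma log_gap_derive (x : R) : 0 < x < 1 -> is_derive log_gap x ((dlogK x - 3 / 4 * dlogA x) / x).
Proof.
intros Hx. replace ((dlogK x - 3 / 4 * dlogA x) / x) with (dlogK x / x - 3 / 4 * (dlogA x / x))
  by (field; lra).
apply (is_derive_minus logK (fun x => 3 / 4 * logA x)); [ now apply logK_derive | ].
apply is_derive_scal. now apply logA_derive.
Qed.

Lemma x_logA_derive (x : R) : 0 < x < 1 -> is_derive (fun x => x * logA x) x (logA x + dlogA x).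
Proof.
intros Hx. replace (logA x + dlogA x) with (1 * logA x + x * (dlogA x / x)) by (field; lra).
apply (is_derive_mult (fun x => x) logA).
- apply (is_derive_id (K := R_AbsRing)).
- now apply logA_derive.
- intros; apply Rmult_comm.
Qed.

Lemma log_gap_deriv_derive (x : R) :
  0 < x < 1 ->
  is_derive (fun x => (dlogK x - 3 / 4 * dlogA x) / x) x
    (numS x (u_inv x) (v_inv x) / (4 * x ^ 2 * (1 - x) ^ 2)).
Proof.
intros Hx.
replace (numS x (u_inv x) (v_inv x) / (4 * x ^ 2 * (1 - x) ^ 2)) with
  ((((- v_inv x ^ 2 + 2 * v_inv x - (1 - x)) / (4 * x * (1 - x) ^ 2)
    - 3 / 4 * (u_inv x * (1 + x - u_inv x) / (4 * x * (1 - x) ^ 2))) * x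
   - (dlogK x - 3 / 4 * dlogA x) * 1) / x ^ 2)
  by (unfold numS, dlogA, dlogK; field; lra).
apply (is_derive_div (fun x => dlogK x - 3 / 4 * dlogA x) (fun x => x)); [ | | lra ].
- apply (is_derive_minus dlogK (fun x => 3 / 4 * dlogA x)); [ now apply dlogK_derive | ].
  apply is_derive_scal. now apply dlogA_derive.
- apply (is_derive_id (K := R_AbsRing)).
Qed.

Lemma logA_dlogA_derive (x : R) :
  0 < x < 1 ->
  is_derive (fun x => logA x + dlogA x) x (denS x (u_inv x) / (4 * x * (1 - x) ^ 2)).
Proof.
intros Hx.
replace (denS x (u_inv x) / (4 * x * (1 - x) ^ 2))
  with (dlogA x / x + u_inv x * (1 + x - u_inv x) / (4 * x * (1 - x) ^ 2))
  by (unfold denS, dlogA; field; lra).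
apply (is_derive_plus logA dlogA); [ now apply logA_derive | now apply dlogA_derive ].
Qed.

Lemma dS_pos (x : R) : 0 < x < 1 -> 0 < denS x (u_inv x) / (4 * x * (1 - x) ^ 2).
Proof.
intros Hx. apply Rdiv_lt_0_compat; [ now apply denS_pos | ].
repeat apply Rmult_lt_0_compat; try apply pow_lt; lra.
Qed.

Lemma log_gap_deriv_derive_S_ratio (x : R) :
  0 < x < 1 ->
  is_derive (fun x => (dlogK x - 3 / 4 * dlogA x) / x) x
    (S_ratio x * (denS x (u_inv x) / (4 * x * (1 - x) ^ 2))).
Proof.
intros Hx. assert (HD := denS_pos x Hx).
replace (S_ratio x * (denS x (u_inv x) / (4 * x * (1 - x) ^ 2)))
  with (numS x (u_inv x) (v_inv x) / (4 * x ^ 2 * (1 - x) ^ 2)) by (unfold S_ratio; field; lra).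
now apply log_gap_deriv_derive.
Qed.

Lemma log_gap_deriv_lim0 : filterlim (fun x => (dlogK x - 3 / 4 * dlogA x) / x) (at_right 0) (locally 0).
Proof.
assert (Ha := dlogA_lim1). assert (Hb := dlogK_lim1).
apply filterlim_ext with (fun x => dlogK x / x - 3 / 4 * (dlogA x / x)).
{ intros x. unfold Rdiv. ring. }
eapply lim_eq; [ | lim_rational ]. field.
Qed.

Lemma logA_dlogA_lim0 : filterlim (fun x => logA x + dlogA x) (at_right 0) (locally 0).
Proof.
assert (Ha := dlogA_lim0). assert (Hb := logA_lim0). eapply lim_eq; [ | lim_rational ]. ring.
Qed.

Lemma log_gap_lim0 : filterlim log_gap (at_right 0) (locally 0).
Proof.
assert (Ha := logK_lim0). assert (Hb := logA_lim0). unfold log_gap.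
eapply lim_eq; [ | lim_rational ]. ring.
Qed.

Lemma x_logA_lim0 : filterlim (fun x => x * logA x) (at_right 0) (locally 0).
Proof. assert (Hb := logA_lim0). eapply lim_eq; [ | lim_rational ]. ring. Qed.

Lemma logA_dlogA_pos (x : R) : 0 < x < 1 -> 0 < logA x + dlogA x.
Proof. intros Hx. assert (H := logA_pos x Hx). assert (H' := dlogA_pos x Hx). lra. Qed.

Lemma lh_ratio_incr : strictly_increasing_01 lh_ratio.
Proof.
exact (lhopital_incr (fun x => (dlogK x - 3 / 4 * dlogA x) / x) (fun x => logA x + dlogA x) S_ratio
  (fun x => denS x (u_inv x) / (4 * x * (1 - x) ^ 2)) log_gap_deriv_lim0 logA_dlogA_lim0
  log_gap_deriv_derive_S_ratio logA_dlogA_derive dS_pos S_ratio_incr).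
Qed.

Lemma lh_ratio_bounds (x : R) : 0 < x < 1 -> 1 / 320 < lh_ratio x < S_ratio x.
Proof.
intros Hx. unfold lh_ratio. split.
- apply (lhopital_gt (fun x => (dlogK x - 3 / 4 * dlogA x) / x) (fun x => logA x + dlogA x) S_ratio
    (fun x => denS x (u_inv x) / (4 * x * (1 - x) ^ 2)) log_gap_deriv_lim0 logA_dlogA_lim0
    log_gap_deriv_derive_S_ratio logA_dlogA_derive dS_pos (1 / 320) x Hx).
  intros t Ht. apply S_ratio_bounds. lra.
- apply (lhopital_lt (fun x => (dlogK x - 3 / 4 * dlogA x) / x) (fun x => logA x + dlogA x) S_ratio
    (fun x => denS x (u_inv x) / (4 * x * (1 - x) ^ 2)) (S_ratio x) x log_gap_deriv_lim0 logA_dlogA_lim0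
    log_gap_deriv_derive_S_ratio logA_dlogA_derive dS_pos Hx).
  intros t Ht. apply S_ratio_incr; lra.
Qed.

Lemma log_gap_derive_lh_ratio (x : R) : 0 < x < 1 -> is_derive log_gap x (lh_ratio x * (logA x + dlogA x)).
Proof.
intros Hx. assert (H := logA_dlogA_pos x Hx).
replace (lh_ratio x * (logA x + dlogA x)) with ((dlogK x - 3 / 4 * dlogA x) / x) by (unfold lh_ratio; field; lra).
now apply log_gap_derive.
Qed.

Lemma f_sq_incr : strictly_increasing_01 f_sq.
Proof.
exact (lhopital_incr log_gap (fun x => x * logA x) lh_ratio (fun x => logA x + dlogA x) log_gap_lim0 x_logA_lim0
  log_gap_derive_lh_ratio x_logA_derive logA_dlogA_pos lh_ratio_incr).
Qed.

Lemma f_sq_gt (x : R) : 0 < x < 1 -> 1 / 320 < f_sq x.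
Proof.
intros Hx.
apply (lhopital_gt log_gap (fun x => x * logA x) lh_ratio (fun x => logA x + dlogA x) log_gap_lim0 x_logA_lim0
  log_gap_derive_lh_ratio x_logA_derive logA_dlogA_pos (1 / 320) x Hx).
intros t Ht. apply lh_ratio_bounds. lra.
Qed.

(** The chain f < [lh_ratio] < S transfers to f both the limit 1/320 of S at 0, by squeezing, and
    its upper bound 1/4. *)
Lemma f_sq_lt_S_ratio (x : R) : 0 < x < 1 -> f_sq x < S_ratio x.
Proof.
intros Hx. apply Rlt_trans with (lh_ratio x); [ | now apply lh_ratio_bounds ].
apply (lhopital_lt log_gap (fun x => x * logA x) lh_ratio (fun x => logA x + dlogA x) (lh_ratio x) x log_gap_lim0 x_logA_lim0
  log_gap_derive_lh_ratio x_logA_derive logA_dlogA_pos Hx).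
intros t Ht. apply lh_ratio_incr; lra.
Qed.

Lemma f_sq_lim0 : filterlim f_sq (at_right 0) (locally (1 / 320)).
Proof.
apply lim_squeeze with (f := fun _ => 1 / 320) (h := S_ratio).
- apply (at_right_0_intro 1); [ lra | ]. intros x Hx.
  assert (H := f_sq_gt x Hx). assert (H' := f_sq_lt_S_ratio x Hx). lra.
- apply lim_const.
- apply S_ratio_lim0.
Qed.

(** At 1 no l'Hopital rule is used: f = (1/4 - (l - m) / l) / x, where l - m converges and l tends
    to infinity. *)
Lemma f_sq_lim1 : filterlim f_sq (at_left 1) (locally (1 / 4)).
Proof.
assert (H1 := logA_inv_lim1). assert (H2 := logA_logK_lim1).
apply lim_ext_at_left_1 with (fun x => (1 / 4 - (logA x - logK x) * / logA x) / x).
- intros x Hx. assert (H := logA_pos x Hx). unfold f_sq, log_gap. field. lra.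
- eapply lim_eq; [ | lim_rational ]; lra.
Qed.

Lemma f_sq_ex_derive (x : R) : 0 < x < 1 -> ex_derive f_sq x.
Proof.
intros Hx. assert (H := logA_pos x Hx). apply ex_derive_div.
- eexists. now apply log_gap_derive.
- eexists. now apply x_logA_derive.
- apply Rmult_integral_contrapositive_currified; lra.
Qed.

Lemma f_sq_onto : maps_01_onto f_sq (1 / 320) (1 / 4).
Proof.
apply onto_of_limits.
- apply f_sq_incr.
- apply f_sq_ex_derive.
- apply f_sq_lim0.
- apply f_sq_lim1.
Qed.

(** * The functions g1 and g4 in the variable x *)

Definition g1_sq (x : R) : R := logA x * (1 / 4 - f_sq x).

Lemma g1_sq_eq (x : R) : 0 < x < 1 -> g1_sq x = logA x / 4 - log_gap x / x.
Proof. intros Hx. assert (H := logA_pos x Hx). unfold g1_sq, f_sq. field. lra. Qed.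

(** This expression is x^2 times the derivative of [g1_sq]. It tends to 0 at 0, and its own
    derivative is a positive multiple of 1/4 - S. *)
Lemma g1_sq_derive_pos (x : R) : 0 < x < 1 -> 0 < x * dlogA x / 4 - (dlogK x - 3 / 4 * dlogA x - log_gap x).
Proof.
revert x.
apply (deriv_pos_pos (fun x => x * dlogA x / 4 - (dlogK x - 3 / 4 * dlogA x - log_gap x))
  (fun x => denS x (u_inv x) / (4 * (1 - x) ^ 2) * (1 / 4 - S_ratio x))).
- assert (Ha := dlogA_lim0). assert (Hb := dlogK_lim0). assert (Hd := log_gap_lim0).
  eapply lim_eq; [ | lim_rational ]; lra.
- intros x Hx. assert (HD := denS_pos x Hx).
  assert (Ha := dlogA_derive x Hx). assert (Hb := dlogK_derive x Hx). assert (Hd := log_gap_derive x Hx).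
  auto_derive.
  + repeat split; eexists; eauto.
  + replace (Derive (fun x0 : R => dlogA x0) x) with (u_inv x * (1 + x - u_inv x) / (4 * x * (1 - x) ^ 2))
      by (symmetry; now apply is_derive_unique).
    replace (Derive (fun x0 : R => dlogK x0) x)
      with ((- v_inv x ^ 2 + 2 * v_inv x - (1 - x)) / (4 * x * (1 - x) ^ 2))
      by (symmetry; now apply is_derive_unique).
    replace (Derive (fun x0 : R => log_gap x0) x) with ((dlogK x - 3 / 4 * dlogA x) / x)
      by (symmetry; now apply is_derive_unique).
    replace (denS x (u_inv x) / (4 * (1 - x) ^ 2) * (1 / 4 - S_ratio x))
      with (denS x (u_inv x) / (16 * (1 - x) ^ 2) - numS x (u_inv x) (v_inv x) / (4 * x * (1 - x) ^ 2))
      by (unfold S_ratio; field; lra).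
    unfold numS, denS, dlogA, dlogK. field. lra.
- intros x Hx. assert (HS := S_ratio_bounds x Hx). apply Rmult_lt_0_compat; [ | lra ].
  apply Rdiv_lt_0_compat; [ now apply denS_pos | ].
  apply Rmult_lt_0_compat; [ lra | apply pow_lt; lra ].
Qed.

Lemma g1_sq_aux_derive (x : R) :
  0 < x < 1 ->
  is_derive (fun x => logA x / 4 - log_gap x / x) x
    ((x * dlogA x / 4 - (dlogK x - 3 / 4 * dlogA x - log_gap x)) / x ^ 2).
Proof.
intros Hx. assert (Hl := logA_derive x Hx). assert (Hd := log_gap_derive x Hx).
auto_derive.
- repeat split; [ eexists; eauto | eexists; eauto | lra ].
- replace (Derive (fun x0 : R => logA x0) x) with (dlogA x / x)
    by (symmetry; now apply is_derive_unique).
  replace (Derive (fun x0 : R => log_gap x0) x) with ((dlogK x - 3 / 4 * dlogA x) / x)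
    by (symmetry; now apply is_derive_unique).
  field. lra.
Qed.

Lemma g1_sq_incr : strictly_increasing_01 g1_sq.
Proof.
intros x y Hx Hxy Hy. rewrite !g1_sq_eq by lra.
apply (deriv_pos_incr (fun x => logA x / 4 - log_gap x / x) _ 0 1 x y g1_sq_aux_derive); auto.
intros t Ht. apply Rdiv_lt_0_compat; [ now apply g1_sq_derive_pos | apply pow_lt; lra ].
Qed.

Lemma g1_sq_onto : maps_01_onto g1_sq 0 (ln (PI / 2)).
Proof.
apply onto_of_limits.
- apply g1_sq_incr.
- intros x Hx. apply (ex_derive_mult logA (fun x => 1 / 4 - f_sq x)).
  + eexists. now apply logA_derive.
  + apply (ex_derive_minus (fun _ => 1 / 4) f_sq); [ apply ex_derive_const | now apply f_sq_ex_derive ].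
- assert (H1 := logA_lim0). assert (H2 := f_sq_lim0). unfold g1_sq.
  eapply lim_eq; [ | lim_rational ]. ring.
- assert (H1 := logA_logK_lim1). assert (H2 := compl_logA_lim1).
  apply lim_ext_at_left_1 with (fun x => (logA x - logK x - (1 - x) * logA x / 4) / x).
  + intros x Hx. rewrite g1_sq_eq by exact Hx. unfold log_gap. field. lra.
  + eapply lim_eq; [ | lim_rational ]; lra.
Qed.

(** The comparison argument with the first Taylor term alone, which needs only t <= t / (1 - t) and
    so holds up to 1. *)
Lemma Zx_ge_third (x : R) : 0 < x < 1 -> x / 3 <= Zx x.
Proof.
intros Hx. apply Rminus_le_0.
apply (comparison_nonneg (fun x => Zx x - x / 3)
  (fun x => (x / (1 - x) - Zx x) / (2 * x) - 1 / 3) x 0 1); try lra.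
- intros t Ht. apply (is_derive_minus Zx (fun x => x / 3)); [ apply Zx_derive; lra | ].
  auto_derive; [ exact I | field ].
- intros t Ht. assert (H := Zx_bounds t ltac:(lra)). lra.
- intros t Ht Hneg. rewrite Rmult_0_l.
  assert (H : t <= t / (1 - t)).
  { apply (Rmult_le_reg_r (1 - t)); [ lra | ].
    replace (t / (1 - t) * (1 - t)) with t by (field; lra). nra. }
  apply (Rmult_le_reg_r (2 * t)); [ lra | ].
  replace (((t / (1 - t) - Zx t) / (2 * t) - 1 / 3) * (2 * t))
    with (t / (1 - t) - Zx t - 2 / 3 * t) by (field; lra). lra.
Qed.

Lemma logA_div_incr : strictly_increasing_01 (fun x => logA x / x).
Proof.
apply (lhopital_incr logA (fun x => x) (fun x => dlogA x / x) (fun _ => 1)).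
- apply logA_lim0.
- apply lim_id_at_right_0.
- intros t Ht. rewrite Rmult_1_r. now apply logA_derive.
- intros t Ht. apply (is_derive_id (K := R_AbsRing)).
- intros; lra.
- intros x y Hx Hxy Hy.
  apply (deriv_pos_incr (fun x => dlogA x / x)
    (fun x => (u_inv x * (1 + x - u_inv x) / (4 * x * (1 - x) ^ 2) * x - dlogA x * 1) / x ^ 2) 0 1); auto.
  + intros t Ht. apply (is_derive_div dlogA (fun x => x)); [ now apply dlogA_derive | | lra ].
    apply (is_derive_id (K := R_AbsRing)).
  + intros t Ht. apply Rdiv_lt_0_compat; [ | apply pow_lt; lra ].
    assert (H := Zx_bounds t Ht). assert (H3 := Zx_ge_third t Ht).
    replace (u_inv t * (1 + t - u_inv t) / (4 * t * (1 - t) ^ 2) * t - dlogA t * 1)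
      with ((- t + 2 * t ^ 2 + Zx t * (3 - 5 * t + 4 * t ^ 2) + 2 * (1 - t) ^ 2 * Zx t ^ 2)
            / (4 * (1 - t) ^ 2 * (1 + Zx t) ^ 2)) by (unfold dlogA, u_inv; field; lra).
    apply Rdiv_lt_0_compat.
    (* Inserting Z >= t/3 in the term linear in Z cancels - t exactly and leaves t^2/3 + 4 t^3/3. *)
    * assert (0 < 3 - 5 * t + 4 * t ^ 2) by nra.
      assert (t / 3 * (3 - 5 * t + 4 * t ^ 2) <= Zx t * (3 - 5 * t + 4 * t ^ 2))
        by (apply Rmult_le_compat_r; lra).
      assert (0 <= (1 - t) ^ 2 * Zx t ^ 2) by (apply Rmult_le_pos; nra).
      assert (0 < t ^ 2) by nra. assert (0 < t ^ 3) by (apply pow_lt; lra). nra.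
    * repeat apply Rmult_lt_0_compat; try apply pow_lt; lra.
Qed.

Definition g4_sq (x : R) : R := logA x / x * (f_sq x - 1 / 320).

Lemma logA_div_pos (x : R) : 0 < x < 1 -> 0 < logA x / x.
Proof. intros Hx. apply Rdiv_lt_0_compat; [ now apply logA_pos | lra ]. Qed.

Lemma g4_sq_incr : strictly_increasing_01 g4_sq.
Proof.
intros x y Hx Hxy Hy. unfold g4_sq.
assert (H1 := logA_div_incr x y Hx Hxy Hy). assert (H2 := f_sq_incr x y Hx Hxy Hy).
assert (H3 := f_sq_gt x ltac:(lra)). assert (H4 := logA_div_pos x ltac:(lra)). simpl in H1.
apply Rmult_le_0_lt_compat; lra.
Qed.

Lemma g4_sq_onto : maps_01_onto g4_sq 0 p_infty.
Proof.
assert (Hf := f_sq_gt (1 / 2) ltac:(lra)).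
apply onto_of_limits.
- apply g4_sq_incr.
- intros x Hx. apply (ex_derive_mult (fun x => logA x / x) (fun x => f_sq x - 1 / 320)).
  + apply ex_derive_div; [ eexists; now apply logA_derive | apply ex_derive_id | lra ].
  + apply (ex_derive_minus f_sq (fun _ => 1 / 320)); [ now apply f_sq_ex_derive | apply ex_derive_const ].
- assert (Hlim := f_sq_lim0).
  apply lim_squeeze with (f := fun _ => 0)
    (h := fun x => logA (1 / 2) / (1 / 2) * (f_sq x - 1 / 320)).
  + apply (at_right_0_intro (1 / 2)); [ lra | ]. intros x Hx. unfold g4_sq.
    assert (H1 := logA_div_incr x (1 / 2) ltac:(lra) ltac:(lra) ltac:(lra)).
    assert (H3 := f_sq_gt x ltac:(lra)). assert (H4 := logA_div_pos x ltac:(lra)). simpl in H1.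
    split; [ apply Rmult_le_pos | apply Rmult_le_compat_r ]; lra.
  + apply lim_const.
  + eapply lim_eq; [ | lim_rational ]; lra.
- intros P [M HM]. unfold filtermap.
  assert (H0 : at_left 1 (fun x => 1 / 2 < x < 1)) by (apply (at_left_1_intro (1 / 2)); [ lra | auto ]).
  (* Beyond 1/2 the second factor is at least [c], and l / x >= l tends to infinity. *)
  set (c := f_sq (1 / 2) - 1 / 320). assert (Hc : 0 < c) by (unfold c; lra).
  apply filter_imp with (2 := filter_and _ _ (logA_large (Rabs M / c)) H0).
  intros x [Hl Hx]. apply HM. unfold g4_sq.
  assert (H2 := f_sq_incr (1 / 2) x ltac:(lra) ltac:(lra) ltac:(lra)).
  assert (H3 := logA_pos x ltac:(lra)). assert (H4 := Rle_abs M).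
  assert (H5 : Rabs M < logA x * c).
  { apply (Rmult_lt_reg_r (/ c)); [ now apply Rinv_0_lt_compat | ].
    rewrite Rmult_assoc, Rinv_r, Rmult_1_r by lra. exact Hl. }
  assert (H6 : logA x <= logA x / x).
  { apply (Rmult_le_reg_r x); [ lra | ].
    replace (logA x / x * x) with (logA x) by (field; lra). nra. }
  assert (logA x * c <= logA x / x * (f_sq x - 1 / 320)); [ | lra ].
  apply Rmult_le_compat; unfold c in *; lra.
Qed.

(** * The functions of r *)

Lemma logA_sqr (r : R) : 0 < r < 1 -> logA (r ^ 2) = ln (arth r / r).
Proof. intros Hr. unfold logA, A_sq. now rewrite sqrt_pow2 by lra. Qed.

Lemma sqr_01 (r : R) : 0 < r < 1 -> 0 < r ^ 2 < 1.
Proof. intros Hr. nra. Qed.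

Lemma ln_arth_pos (r : R) : 0 < r < 1 -> 0 < ln (arth r / r).
Proof. intros Hr. rewrite <- logA_sqr by exact Hr. now apply logA_pos, sqr_01. Qed.

Lemma f_sq_sqr (r : R) : 0 < r < 1 ->
  f_sq (r ^ 2) = (ln (2 * ellK r / PI) - 3 / 4 * ln (arth r / r)) / (r ^ 2 * ln (arth r / r)).
Proof.
intros Hr. rewrite <- logA_sqr by exact Hr. reflexivity.
Qed.

Lemma fG_f_sq (r : R) : 0 < r < 1 -> fG r = f_sq (r ^ 2).
Proof.
intros Hr. assert (H := ln_arth_pos r Hr). rewrite f_sq_sqr by exact Hr.
unfold fG, G. field. lra.
Qed.

Lemma g1_g1_sq (r : R) : 0 < r < 1 -> g1 r = g1_sq (r ^ 2).
Proof.
intros Hr. assert (H := ln_arth_pos r Hr). unfold g1_sq. rewrite f_sq_sqr, logA_sqr by exact Hr.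
unfold g1. field. lra.
Qed.

Lemma g2_f_sq (r : R) : 0 < r < 1 -> g2 r = 1 / 4 - f_sq (r ^ 2).
Proof.
intros Hr. assert (H := ln_arth_pos r Hr). rewrite f_sq_sqr by exact Hr.
unfold g2, g1. field. lra.
Qed.

Lemma g3_f_sq (r : R) : 0 < r < 1 -> g3 r = f_sq (r ^ 2) - 1 / 320.
Proof.
intros Hr. assert (H := ln_arth_pos r Hr). rewrite f_sq_sqr by exact Hr.
unfold g3. field. lra.
Qed.

Lemma g4_g4_sq (r : R) : 0 < r < 1 -> g4 r = g4_sq (r ^ 2).
Proof.
intros Hr. assert (H := ln_arth_pos r Hr). unfold g4_sq. rewrite f_sq_sqr, logA_sqr by exact Hr.
unfold g4. field. lra.
Qed.

Lemma G_f_sq (r : R) : 0 < r < 1 -> G r = 3 / 4 + r ^ 2 * f_sq (r ^ 2).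
Proof.
intros Hr. assert (H := ln_arth_pos r Hr). rewrite f_sq_sqr by exact Hr.
unfold G. field. lra.
Qed.

Lemma f_sq_lt (x : R) : 0 < x < 1 -> f_sq x < 1 / 4.
Proof. intros Hx. assert (H := f_sq_lt_S_ratio x Hx). assert (H' := S_ratio_bounds x Hx). lra. Qed.

Lemma G_incr : strictly_increasing_01 (fun x => 3 / 4 + x * f_sq x).
Proof.
intros x y Hx Hxy Hy. assert (H := f_sq_incr x y Hx Hxy Hy).
assert (H1 := f_sq_gt x ltac:(lra)). nra.
Qed.

Lemma G_onto : maps_01_onto (fun x => 3 / 4 + x * f_sq x) (3 / 4) 1.
Proof.
apply onto_of_limits.
- apply G_incr.
- intros x Hx. apply (ex_derive_plus (fun _ => 3 / 4) (fun x => x * f_sq x));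
    [ apply ex_derive_const | ].
  apply (ex_derive_mult (fun x => x) f_sq); [ apply ex_derive_id | now apply f_sq_ex_derive ].
- assert (H := f_sq_lim0). eapply lim_eq; [ | lim_rational ]. ring.
- assert (H := f_sq_lim1). eapply lim_eq; [ | lim_rational ]. field.
Qed.

Lemma onto_reflect (g h : R -> R) (c a b : R) :
  (forall r, 0 < r < 1 -> g r = c - h r) -> maps_01_onto h a b -> maps_01_onto g (c - b) (c - a).
Proof.
intros Hg Hh y. destruct (Hh (c - y)) as [H1 H2]. simpl in *. split.
- intros [r [Hr <-]]. rewrite Hg in * by exact Hr.
  assert (a < c - (c - h r) < b) by (apply H1; exists r; split; [ exact Hr | ring ]). lra.
- intros Hy. destruct H2 as [r [Hr He]]; [ lra | ]. exists r. split; [ exact Hr | ].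
  rewrite Hg by exact Hr. lra.
Qed.

Lemma onto_translate (g h : R -> R) (c a b : R) :
  (forall r, 0 < r < 1 -> g r = h r - c) -> maps_01_onto h a b -> maps_01_onto g (a - c) (b - c).
Proof.
intros Hg Hh y. destruct (Hh (y + c)) as [H1 H2]. simpl in *. split.
- intros [r [Hr <-]]. rewrite Hg in * by exact Hr.
  assert (a < h r - c + c < b) by (apply H1; exists r; split; [ exact Hr | ring ]). lra.
- intros Hy. destruct H2 as [r [Hr He]]; [ lra | ]. exists r. split; [ exact Hr | ].
  rewrite Hg by exact Hr. lra.
Qed.

Lemma Rpower_pos (a b : R) : 0 < Rpower a b.
Proof. apply exp_pos. Qed.

Lemma ellK_pos (r : R) : 0 < r < 1 -> 0 < ellK r.
Proof.
intros Hr. rewrite ellK_K_sq. assert (H := K_sq_ge_PI2 _ (sqr_01 r Hr)).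
assert (HP := PI_RGT_0). lra.
Qed.

Lemma ln_ellK (r : R) : 0 < r < 1 ->
  ln (ellK r) = ln (PI / 2) + (3 / 4 + r ^ 2 * f_sq (r ^ 2)) * ln (arth r / r).
Proof.
intros Hr. assert (H := ln_arth_pos r Hr). assert (HP := PI_RGT_0). assert (HK := ellK_pos r Hr).
rewrite <- G_f_sq by exact Hr. unfold G.
replace (ln (2 * ellK r / PI) / ln (arth r / r) * ln (arth r / r)) with (ln (2 * ellK r / PI))
  by (field; lra).
rewrite <- ln_mult by (apply Rdiv_lt_0_compat; lra). f_equal. field. lra.
Qed.

(** The sign of the difference is that of c - f, so each power bound on K at r is a comparison of
    its constant with f, and the best constants are the ends of the range of f. *)
Lemma ln_power_sub_ln_ellK (r c : R) : 0 < r < 1 ->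
  ln (PI / 2 * Rpower (arth r / r) (3 / 4 + c * r ^ 2)) - ln (ellK r)
  = (c - f_sq (r ^ 2)) * (r ^ 2 * ln (arth r / r)).
Proof.
intros Hr. assert (HP := PI_RGT_0). assert (Hp := Rpower_pos (arth r / r) (3 / 4 + c * r ^ 2)).
rewrite ln_mult, ln_Rpower, ln_ellK by lra. ring.
Qed.

Lemma power_lt_ellK (r c : R) : 0 < r < 1 ->
  (PI / 2 * Rpower (arth r / r) (3 / 4 + c * r ^ 2) < ellK r <-> c < f_sq (r ^ 2)).
Proof.
intros Hr. assert (H := ln_arth_pos r Hr). assert (HP := PI_RGT_0). assert (HK := ellK_pos r Hr).
assert (Hx := sqr_01 r Hr). assert (Hp := Rpower_pos (arth r / r) (3 / 4 + c * r ^ 2)).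
assert (Hd := ln_power_sub_ln_ellK r c Hr).
assert (Hrl : 0 < r ^ 2 * ln (arth r / r)) by (apply Rmult_lt_0_compat; lra).
split; intros Hc.
- apply ln_increasing in Hc; [ nra | apply Rmult_lt_0_compat; lra ].
- apply ln_lt_inv; [ apply Rmult_lt_0_compat; lra | exact HK | nra ].
Qed.

Lemma ellK_lt_power (r c : R) : 0 < r < 1 ->
  (ellK r < PI / 2 * Rpower (arth r / r) (3 / 4 + c * r ^ 2) <-> f_sq (r ^ 2) < c).
Proof.
intros Hr. assert (H := ln_arth_pos r Hr). assert (HP := PI_RGT_0). assert (HK := ellK_pos r Hr).
assert (Hx := sqr_01 r Hr). assert (Hp := Rpower_pos (arth r / r) (3 / 4 + c * r ^ 2)).
assert (Hd := ln_power_sub_ln_ellK r c Hr).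
assert (Hrl : 0 < r ^ 2 * ln (arth r / r)) by (apply Rmult_lt_0_compat; lra).
split; intros Hc.
- apply ln_increasing in Hc; [ nra | exact HK ].
- apply ln_lt_inv; [ exact HK | apply Rmult_lt_0_compat; lra | nra ].
Qed.

Lemma g1_sq_lt (x : R) : 0 < x < 1 -> g1_sq x < ln (PI / 2).
Proof. intros Hx. now apply (proj1 (g1_sq_onto (g1_sq x))); exists x. Qed.

(** After taking logarithms, the right side minus the left side is r^2 (ln (pi/2) - g1). *)
Lemma ellK_gt_mixed_power (r : R) : 0 < r < 1 ->
  Rpower (PI / 2) (1 - r ^ 2) * Rpower (arth r / r) (3 / 4 + r ^ 2 / 4) < ellK r.
Proof.
intros Hr. assert (H := ln_arth_pos r Hr). assert (HK := ellK_pos r Hr).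
assert (Hx := sqr_01 r Hr). assert (Hg := g1_sq_lt _ Hx). unfold g1_sq in Hg.
rewrite logA_sqr in Hg by exact Hr.
apply ln_lt_inv; [ apply Rmult_lt_0_compat; apply Rpower_pos | exact HK | ].
rewrite ln_mult by apply Rpower_pos. rewrite !ln_Rpower, ln_ellK by exact Hr. nra.
Qed.

Theorem theorem1p7 :
  (* (1) *)
  ((strictly_increasing_01 g1 /\ maps_01_onto g1 0 (ln (PI / 2))) /\
   (strictly_decreasing_01 g2 /\ maps_01_onto g2 0 (79 / 320)))
  /\
  (* (2) *)
  ((strictly_increasing_01 g3 /\ maps_01_onto g3 0 (79 / 320)) /\
   (strictly_increasing_01 g4 /\ maps_01_onto g4 0 p_infty))
  /\
  (* (3) *)
  ((strictly_increasing_01 fG /\ maps_01_onto fG (1 / 320) (1 / 4)) /\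
   (strictly_increasing_01 G /\ maps_01_onto G (3 / 4) 1) /\
   (forall alpha beta : R,
      (forall r : R, 0 < r < 1 ->
         PI / 2 * Rpower (arth r / r) (3 / 4 + alpha * r ^ 2) < ellK r /\
         ellK r < PI / 2 * Rpower (arth r / r) (3 / 4 + beta * r ^ 2))
      <-> (alpha <= 1 / 320 /\ beta >= 1 / 4)) /\
   (forall r : R, 0 < r < 1 ->
      Rpower (PI / 2) (1 - r ^ 2) * Rpower (arth r / r) (3 / 4 + r ^ 2 / 4)
        < ellK r /\
      ellK r < PI / 2 * Rpower (arth r / r) (3 / 4 + r ^ 2 / 4))).
Proof.
assert (Hf : strictly_increasing_01 fG) by exact (incr_comp_sqr fG f_sq fG_f_sq f_sq_incr).
assert (Hfo : maps_01_onto fG (1 / 320) (1 / 4))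
  by exact (onto_comp_sqr fG f_sq (1 / 320) (1 / 4) fG_f_sq f_sq_onto).
assert (H2 : forall r, 0 < r < 1 -> g2 r = 1 / 4 - fG r).
{ intros r Hr. now rewrite fG_f_sq, g2_f_sq. }
assert (H3 : forall r, 0 < r < 1 -> g3 r = fG r - 1 / 320).
{ intros r Hr. now rewrite fG_f_sq, g3_f_sq. }
split; [ split; split | split; [ split; split | split; [ split | split; [ split | split ] ] ] ].
- exact (incr_comp_sqr g1 g1_sq g1_g1_sq g1_sq_incr).
- exact (onto_comp_sqr g1 g1_sq 0 (ln (PI / 2)) g1_g1_sq g1_sq_onto).
- intros x y Hx Hxy Hy. rewrite !H2 by lra. specialize (Hf x y Hx Hxy Hy). lra.
- assert (H := onto_reflect g2 fG (1 / 4) (1 / 320) (1 / 4) H2 Hfo).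
  replace (1 / 4 - 1 / 4) with 0 in H by lra. now replace (79 / 320) with (1 / 4 - 1 / 320) by lra.
- intros x y Hx Hxy Hy. rewrite !H3 by lra. specialize (Hf x y Hx Hxy Hy). lra.
- assert (H := onto_translate g3 fG (1 / 320) (1 / 320) (1 / 4) H3 Hfo).
  replace (1 / 320 - 1 / 320) with 0 in H by lra.
  now replace (79 / 320) with (1 / 4 - 1 / 320) by lra.
- exact (incr_comp_sqr g4 g4_sq g4_g4_sq g4_sq_incr).
- exact (onto_comp_sqr g4 g4_sq 0 p_infty g4_g4_sq g4_sq_onto).
- exact Hf.
- exact Hfo.
- exact (incr_comp_sqr G _ G_f_sq G_incr).
- exact (onto_comp_sqr G _ (3 / 4) 1 G_f_sq G_onto).
- intros alpha beta. split.
  + intros H. split.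
    * destruct (Rle_or_lt alpha (1 / 320)) as [Ha | Ha]; [ exact Ha | exfalso ].
      (* The value 1/8 is an arbitrary point of (1/320, 1/4): it keeps the target in the range even
         if alpha >= 1/4. At the point found, f <= alpha, against the assumed bound. *)
      destruct (proj2 (Hfo (Rmin alpha (1 / 8)))) as [r [Hr He]].
      { split; simpl.
        - apply Rmin_glb_lt; lra.
        - apply Rle_lt_trans with (1 := Rmin_r _ _). lra. }
      assert (Hl := proj1 (power_lt_ellK r alpha Hr) (proj1 (H r Hr))).
      rewrite fG_f_sq in He by exact Hr. assert (Hm := Rmin_l alpha (1 / 8)). lra.
    * destruct (Rlt_or_le beta (1 / 4)) as [Hb | Hb]; [ exfalso | lra ].
      (* Likewise, the maximum stays in the range however small beta is, and f >= beta at the point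
         found. *)
      destruct (proj2 (Hfo (Rmax beta (1 / 8)))) as [r [Hr He]].
      { split; simpl.
        - apply Rlt_le_trans with (2 := Rmax_r _ _). lra.
        - apply Rmax_lub_lt; lra. }
      assert (Hl := proj1 (ellK_lt_power r beta Hr) (proj2 (H r Hr))).
      rewrite fG_f_sq in He by exact Hr. assert (Hm := Rmax_l beta (1 / 8)). lra.
  + intros [Ha Hb] r Hr. assert (Hx := sqr_01 r Hr). split.
    * apply power_lt_ellK; [ exact Hr | ]. assert (Hg := f_sq_gt _ Hx). lra.
    * apply ellK_lt_power; [ exact Hr | ]. assert (Hg := f_sq_lt _ Hx). lra.
- intros r Hr. split; [ now apply ellK_gt_mixed_power | ].
  replace (3 / 4 + r ^ 2 / 4) with (3 / 4 + 1 / 4 * r ^ 2) by field.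
  apply ellK_lt_power; [ exact Hr | ]. now apply f_sq_lt, sqr_01.
Qed.
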